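(* Let $s,N,m\in\mathbb N$, $n=N^s$, and let $\pi\in P_{even}(2s,2s)$ be a partition which is symmetric, $\pi=\pi^\circ$, and which is such that $\varphi_\pi,\varphi_{\pi^*}$ are unital modulo scalars. For $d\in\mathbb N$ let $W$ be a complex Wishart matrix of parameters $(dn,dm)$, and consider the block-modified Wishart matrix $\tilde W=(id\otimes\varphi_\pi)W$. Then $$m\tilde W\sim\pi_{mn\rho}$$ in $*$-moments, in the $d\to\infty$ limit, where $\rho=law(\Lambda_\pi)$.
   Context: $P_{even}(2s,2s)$ is the set of partitions of an upper row of $2s$ points together with a lower row of $2s$ points, with all blocks of even size. $\pi^\circ$ is the image of $\pi$ under exchanging $i\leftrightarrow i+s$ in each row ($i=1,\ldots,s$), and $\pi^*$ is obtained by turning $\pi$ upside-down (exchanging the two rows). With multi-indices in $\{1,\ldots,N\}^s$ labelling the basis of $\mathbb C^n$, $\varphi_\pi:M_n(\mathbb C)\to M_n(\mathbb C)$ is the linear map $$\varphi_\pi(e_{a_1\ldots a_s,c_1\ldots c_s})=\sum_{b_1\ldots b_s}\sum_{d_1\ldots d_s}\delta_\pi\begin{pmatrix}a_1&\ldots&a_s&c_1&\ldots&c_s\\ b_1&\ldots&b_s&d_1&\ldots&d_s\end{pmatrix}e_{b_1\ldots b_s,d_1\ldots d_s},$$ where $\delta_\pi=1$ if each block of $\pi$ contains equal indices and $0$ otherwise. A map $\varphi$ is unital modulo scalars if $\varphi(1)=c1$ for some $c\in\mathbb C$. The matrix $\Lambda_\pi=\sum(\Lambda_\pi)_{ab,cd}\,e_{ac}\otimes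 e_{bd}\in M_n(\mathbb C)\otimes M_n(\mathbb C)$ has entries $(\Lambda_\pi)_{ab,cd}=\varphi_\pi(e_{ac})_{bd}$. $law(\Lambda_\pi)$ is its $*$-distribution with respect to the normalized trace (for a self-adjoint matrix, its normalized eigenvalue counting measure). Wishart matrix: $G$ is a $dn\times dm$ matrix with independent complex $\mathcal N(0,1)$ entries (centered, $\mathbb E|G_{ij}|^2=1$), and $W=\frac{1}{dm}GG^*\in M_d(\mathbb C)\otimes M_n(\mathbb C)$, a $d\times d$ array of $n\times n$ blocks; $id\otimes\varphi_\pi$ applies $\varphi_\pi$ to each block. Convergence in $*$-moments means that for every $p\in\mathbb N$ and $e\in\{1,*\}^p$, $(\mathbb E\circ tr)((m\tilde W)^{e_1}\cdots(m\tilde W)^{e_p})$ converges as $d\to\infty$ to the corresponding $*$-moment of $\pi_{mn\rho}$ ($tr$ the normalized trace). Compound free Poisson law: for a positive measure $\mu$ of mass $c>0$, $\pi_\mu=\lim_{k\to\infty}\left(\left(1-\frac ck\right)\delta_0+\frac1k\mu\right)^{\boxplus k}$; it is the $*$-distribution whose free $*$-cumulants are the $*$-moments of $\mu$. *)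

(* Defs.v *)
(* Complex numbers are R[i], with R : realType. *)
From HB Require Import structures.
From mathcomp Require Import all_boot all_order all_algebra.
From mathcomp Require Import all_classical all_reals all_analysis.
From mathcomp Require Import complex mxtens.

Set Implicit Arguments.
Unset Strict Implicit.
Unset Printing Implicit Defensive.

Import Order.TTheory GRing.Theory Num.Theory numFieldNormedType.Exports.
Local Open Scope classical_set_scope.
Local Open Scope complex_scope.
Local Open Scope ring_scope.

(** * Partitions *)

(* The points of a partition in P(k, l): [inl i] is the i-th point of the upper
   row and [inr j] the j-th point of the lower row. *)
Definition row_point (k l : nat) : finType := ('I_k + 'I_l)%type.

Definition Peven (k l : nat) : {set {set {set row_point k l}}} :=
  [set p : {set {set row_point k l}} |
    finset.partition p [set: row_point k l]%SET
    && [forall B in p, ~~ odd #|(B : {set row_point k l})|]]%SET.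

Definition relabel (S T : finType) (h : S -> T) (p : {set {set S}}) :
    {set {set T}} := [set h @: (B : {set S}) | B in p]%SET.

Definition half_swap (s : nat) (i : 'I_(s + s)) : 'I_(s + s) :=
  match fintype.split i with inl j => rshift s j | inr j => lshift s j end.

(* p°: exchange i <-> i + s in each row of 2s points. *)
Definition pcirc (s : nat) (p : {set {set row_point (s + s)%N (s + s)%N}}) :
    {set {set row_point (s + s)%N (s + s)%N}} :=
  relabel (fun x : row_point (s + s)%N (s + s)%N =>
             match x with
             | inl i => inl (half_swap i)
             | inr i => inr (half_swap i)
             end) p.

(* p^*: turn p upside-down. *)
Definition pstar (k l : nat) (p : {set {set row_point k l}}) :
    {set {set row_point l k}} :=
  relabel (fun x : row_point k l =>
             match x return row_point l k with inl i => inr i | inr j => inl j end) p.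

Definition delta (N k l : nat) (p : {set {set row_point k l}})
    (up : 'I_k -> 'I_N) (lo : 'I_l -> 'I_N) : bool :=
  let v (x : row_point k l) := match x with inl i => up i | inr j => lo j end in
  [forall B in p, forall x in (B : {set row_point k l}),
     forall y in (B : {set row_point k l}), v x == v y].

(** * The map phi_p and the matrix Lambda_p *)

Lemma card_multi_index (s N : nat) : #|{ffun 'I_s -> 'I_N}| = (N ^ s)%N.
Proof. by rewrite card_ffun !card_ord. Qed.

(* The basis of C^(N^s) is labelled by multi-indices in {1, ..., N}^s through
   the enumeration of {ffun 'I_s -> 'I_N}. *)
Definition multi_index (s N : nat) (a : 'I_(N ^ s)) : {ffun 'I_s -> 'I_N} :=
  enum_val (cast_ord (esym (card_multi_index s N)) a).

(* The row a_1 ... a_s c_1 ... c_s. *)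
Definition row_index (s N : nat) (a c : 'I_(N ^ s)) (i : 'I_(s + s)) : 'I_N :=
  match fintype.split i with inl j => multi_index a j | inr j => multi_index c j end.

(* The linear extension of
   e_(a,c) |-> \sum_(b,d) delta_p (a c / b d) e_(b,d). *)
Definition phi (R : realType) (s N : nat)
    (p : {set {set row_point (s + s)%N (s + s)%N}}) (x : 'M[R[i]]_(N ^ s)) :
    'M[R[i]]_(N ^ s) :=
  \sum_(a < N ^ s) \sum_(c < N ^ s)
    x a c *: \sum_(b < N ^ s) \sum_(d < N ^ s)
      (delta p (row_index a c) (row_index b d))%:R *: delta_mx b d.

Definition unital_mod_scalars (R : realType) (n : nat)
    (f : 'M[R[i]]_n -> 'M[R[i]]_n) : Prop :=
  exists c : R[i], f 1%:M = c%:M.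

(* M_k (x) M_l is 'M_(k * l), elementary tensors being Kronecker products
   [A *t B], with (i, a) at position [mxtens_index (i, a)]. *)
Definition Lambda (R : realType) (n : nat) (f : 'M[R[i]]_n -> 'M[R[i]]_n) :
    'M[R[i]]_(n * n) :=
  \sum_(a < n) \sum_(b < n) \sum_(c < n) \sum_(d < n)
    f (delta_mx a c) b d *: (delta_mx a c *t delta_mx b d).

(* (id (x) f) W: apply f to each n x n block of W. *)
Definition block_map (R : realType) (d n : nat)
    (f : 'M[R[i]]_n -> 'M[R[i]]_n) (W : 'M[R[i]]_(d * n)) : 'M[R[i]]_(d * n) :=
  \sum_(i < d) \sum_(j < d)
    (delta_mx i j
     *t f (\matrix_(a < n, c < n) W (mxtens_index (i, a)) (mxtens_index (j, c)))).

(** * *-distributions *)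

Definition adjmx (R : realType) (k l : nat) (A : 'M[R[i]]_(k, l)) :
    'M[R[i]]_(l, k) := (map_mx Num.conj A)^T.

(* A *-distribution is recorded by its *-moments, indexed by the words e in
   {1, *}^p, p in N; the letter * is [true]. The value at the empty word is the
   total mass. *)
Definition star_distribution (R : realType) : Type := seq bool -> R[i].

(* The *-distribution of a matrix, with respect to the normalized trace. *)
Definition law (R : realType) (n : nat) (A : 'M[R[i]]_n) :
    star_distribution R :=
  fun e => \tr (\prod_(b <- e) (if b then adjmx A else A)) / n%:R.

Definition scale_distribution (R : realType) (c : R[i])
    (mu : star_distribution R) : star_distribution R := fun e => c * mu e.

Definition noncrossing (p : nat) (sigma : {set {set 'I_p}}) : bool :=
  finset.partition sigma [set: 'I_p]%SET
  && [forall B in sigma, forall C in sigma, (B != C) ==>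
       [forall i in (B : {set 'I_p}), forall j in (C : {set 'I_p}),
        forall k in (B : {set 'I_p}), forall l in (C : {set 'I_p}),
          ~~ [&& (i < j)%N, (j < k)%N & (k < l)%N]]].

(* The subword of e at the positions in V; [enum V] is increasing. *)
Definition subword (e : seq bool) (V : {set 'I_(size e)}) : seq bool :=
  [seq tnth (in_tuple e) i | i <- enum V].

(* The *-distribution with free *-cumulants kappa, by the moment-cumulant
   formula; here kappa e is the cumulant kappa_p(a^e1, ..., a^ep). *)
Definition distribution_of_free_cumulants (R : realType)
    (kappa : seq bool -> R[i]) : star_distribution R :=
  fun e => \sum_(sigma : {set {set 'I_(size e)}} | noncrossing sigma)
             \prod_(V in sigma) kappa (subword V).

(* The compound free Poisson law pi_mu: its free *-cumulants are the *-moments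
   of mu. *)
Definition compound_free_poisson (R : realType) (mu : star_distribution R) :
    star_distribution R := distribution_of_free_cumulants mu.

(** * Random matrices *)

Definition mutually_independent (R : realType) (disp : measure_display)
    (T : measurableType disp) (P : probability T R) (I : finType)
    (X : I -> {RV P >-> R}) : Prop :=
  forall (J : {set I}) (B : I -> set R),
    (forall i, measurable (B i)) ->
    P (\bigcap_(i in [set` J]) (X i @^-1` B i))
    = (\prod_(i in J) P (X i @^-1` B i))%E.

(* Independent complex N(0, 1) entries: the real parts X (i, j, false) and the
   imaginary parts X (i, j, true) of all the entries are independent centered
   real Gaussians of variance 1/2, so that E |G_ij|^2 = 1. The second parameter
   of [normal_prob] is the standard deviation. *)
Definition complex_gaussian_matrix (R : realType) (disp : measure_display)
    (T : measurableType disp) (P : probability T R) (k l : nat)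
    (G : T -> 'M[R[i]]_(k, l)) : Prop :=
  exists X : 'I_k * 'I_l * bool -> {RV P >-> R},
    [/\ mutually_independent X,
        forall z (B : set R), measurable B ->
          distribution P (X z) B = normal_prob 0 (Num.sqrt 2^-1) B
      & forall t i j, G t i j = X (i, j, false) t +i* X (i, j, true) t].

Definition complex_wishart (R : realType) (disp : measure_display)
    (T : measurableType disp) (P : probability T R) (k l : nat)
    (W : T -> 'M[R[i]]_k) : Prop :=
  exists G : T -> 'M[R[i]]_(k, l),
    complex_gaussian_matrix P G
    /\ forall t, W t = l%:R^-1 *: (G t *m adjmx (G t)).

Definition complex_expectation (R : realType) (disp : measure_display)
    (T : measurableType disp) (P : probability T R) (Z : T -> R[i]) : R[i] :=
  fine ('E_P[fun t => complex.Re (Z t)])%E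
  +i* fine ('E_P[fun t => complex.Im (Z t)])%E.

(* Convergence in *-moments, with respect to E o tr, of random matrices A d of
   size k d, as d -> oo; R[i]^o carries the topology of the modulus. *)
Definition cvg_in_star_moments (R : realType) (disp : nat -> measure_display)
    (T : forall d, measurableType (disp d)) (P : forall d, probability (T d) R)
    (k : nat -> nat) (A : forall d, T d -> 'M[R[i]]_(k d))
    (mu : star_distribution R) : Prop :=
  forall e : seq bool,
    (fun d => complex_expectation (P d) (fun t => law (A d t) e) : R[i]^o)
      @ \oo --> (mu e : R[i]^o).

(* Main.v *)
Require Import Defs.
(** The entries of phi_p being 0 or 1, the symmetry p = p° makes both
    X = m (id (x) phi_p) W and Lambda = Lambda_p self-adjoint, so that only the
    length q of a word matters. Let g be the full cycle of S_q. Wick's formula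
    writes E tr X^q as a sum over t in S_q of m^#(t) times
    d^(#(t^-1 g) + #(t) - q - 1), # being the number of cycles, times a
    contraction of q copies of Lambda, whose first legs are joined along t and
    whose second legs are joined along g. By the genus bound the exponent of d
    is nonpositive, and it vanishes exactly for the t on a geodesic from 1 to
    g; such a t is determined by its set of cycles, an arbitrary noncrossing
    partition.

    It remains to see that for these t the contraction splits into the factors
    tr Lambda^|V|, V a cycle of t, which gives the moment-cumulant formula. This
    holds because the trace of Lambda^l over the first leg is a scalar. To see
    that, identify the points i and i + s of the upper row: since phi_p(1) is a
    scalar, the connected component of the lower point i then meets the lower
    row exactly in {i, i + s}. Evenness of the blocks makes the partial trace
    diagonal, and permuting the colours {1, ..., N} component by component
    makes its diagonal constant. The contraction is then computed by removing
    the points one at a time: if g <> 1, a geodesic t has a point k moved by g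
    with t k = k or t k = g k. *)
From HB Require Import structures.
From mathcomp Require Import all_boot all_order all_algebra all_fingroup.
From mathcomp Require Import all_classical all_reals all_analysis.
From mathcomp Require Import measurable_realfun.
From mathcomp Require Import complex mxtens.
From mathcomp Require Import zify ring.

Set Implicit Arguments.
Unset Strict Implicit.
Unset Printing Implicit Defensive.

Import Order.TTheory GRing.Theory Num.Theory numFieldNormedType.Exports.

(** * Cycle counts under transpositions, the genus bound and its equality case *)

Lemma ltn_subS a b n : a - b < n.+1 -> b < a -> a - b.+1 < n.
Proof. lia. Qed.

Section Geodesics.
Variable T : finType.
Implicit Types (g t s : {perm T}) (x y u w : T).
Local Open Scope group_scope.

Lemma card_porbits_le s : #|porbits s| <= #|T|.
Proof. by rewrite /porbits (leq_trans (leq_imset_card _ _)). Qed.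

Lemma card_porbits_split s x y : x != y -> y \in porbit s x ->
  #|porbits (tperm x y * s)| = #|porbits s|.+1.
Proof.
move=> xy yx; have := porbits_mul_tperm s x y.
by rewrite /= porbit_sym yx addn0 xy addn1.
Qed.

Lemma card_porbits_tperm_le s x y :
  #|porbits (tperm x y * s)| <= #|porbits s|.+1.
Proof.
have := porbits_mul_tperm s x y; rewrite /= => H.
by apply: (leq_trans (leq_addr (x \notin porbit s y).*2 _)); rewrite H -addn1 leq_add2l leq_b1.
Qed.

Lemma card_porbits_mulC_tperm s x y :
  #|porbits (s * tperm x y)| = #|porbits (tperm x y * s^-1)|.
Proof. by rewrite -porbitsV invMg tpermV. Qed.

Lemma card_porbits1 : #|porbits (1 : {perm T})| = #|T|.
Proof.
rewrite /porbits card_imset // => x y /= exy.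
have : y \in porbit (1 : {perm T}) x by rewrite exy porbit_id.
by case/porbitP => i ->; rewrite expg1n perm1.
Qed.

(** Splitting a cycle of t by a transposition raises #(t) by one and lowers #(t^-1 g) by at most
    one, so the left side does not decrease. Repeated splitting ends at t = 1, where equality
    holds. *)
Lemma genus_bound g t :
  #|porbits (t^-1 * g)| + #|porbits t| <= #|T| + #|porbits g|.
Proof.
have [n] := ubnP (#|T| - #|porbits t|); elim: n => // n IH in t *.
have [-> _|/eqP t1] := eqVneq t 1.
  by rewrite invg1 mul1g card_porbits1 addnC.
have [x tx] : exists x, x != t x.
  apply/existsP; rewrite -negb_forall; apply/negP => /forallP H.
  by apply: t1; apply/permP => x; rewrite perm1 -(eqP (H x)).
set t' := t * tperm x (t x) => Hn.
have ct' : #|porbits t'| = #|porbits t|.+1.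
  rewrite card_porbits_mulC_tperm card_porbits_split ?porbitsV //.
  by rewrite porbitV (mem_porbit t 1).
have et : t^-1 * g = tperm x (t x) * (t'^-1 * g).
  by rewrite /t' invMg tpermV !mulgA tperm2 mul1g.
have := IH t'; rewrite ct' => /(_ _)/wrap[].
  by have := card_porbits_le t'; rewrite ct'; exact: ltn_subS.
apply: leq_trans; rewrite addnS -addSn leq_add2r et.
exact: card_porbits_tperm_le.
Qed.

(** Equality in the genus bound. With the length |s| = #T - #(s) it reads |t| + |t^-1 g| = |g|: t
    lies on a geodesic from 1 to g in the Cayley graph generated by the transpositions. *)
Definition geodesic g t :=
  #|porbits (t^-1 * g)| + #|porbits t| == #|T| + #|porbits g|.

(* Otherwise multiplying by the transposition of u and w would split a cycle of
   both t and t^-1 g, against the genus bound. *)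
Lemma geodesic_transverse g t u w : geodesic g t ->
  w \in porbit t u -> w \in porbit (t^-1 * g) u -> u = w.
Proof.
move=> /eqP geo wt wg; apply/eqP/negP => /negP uw.
have := genus_bound g (t * tperm u w).
rewrite card_porbits_mulC_tperm invMg tpermV -mulgA.
rewrite !card_porbits_split ?porbitV //.
by rewrite porbitsV addSn addnS geo ltnNge leqnSn.
Qed.

Lemma geodesicxx g : geodesic g g.
Proof. by rewrite /geodesic mulVg card_porbits1. Qed.

(* The permutation tperm k (t k) * t fixes t k and is otherwise obtained from t
   by leaving out t k from its cycle. *)
Lemma porbit_skip t k x y : k != t k -> x != t k -> y != t k ->
  (y \in porbit (tperm k (t k) * t) x) = (y \in porbit t x).
Proof.
set u := t k; set t' := _ * t => ku xu yu.
have t'E z : z != k -> z != u -> t' z = t z.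
  by move=> zk zu; rewrite permM tpermD // eq_sym.
have t'k : t' k = t u by rewrite permM tpermL.
have t'u : t' u = u by rewrite permM tpermR.
have memS s z v : z \in porbit s v -> s z \in porbit s v.
  by case/porbitP => i ->; rewrite -permM -expgSr mem_porbit.
apply/porbitP/porbitP => -[i yE]; apply/porbitP.
  rewrite {}yE {yu}; elim: i => [|i IH]; first by rewrite expg0 perm1 porbit_id.
  rewrite expgSr permM; move: IH; set z := (t' ^+ i) x => IH.
  have [zk|zk] := eqVneq z k; first by rewrite zk t'k !memS // -zk.
  have [zu|zu] := eqVneq z u; first by rewrite zu t'u -zu.
  by rewrite t'E // memS.
(* The permutation t' jumps over u, so when the t-orbit of x sits at u the invariant speaks of its
   predecessor k instead. *)
suff H j : if (t ^+ j) x == u then k \in porbit t' x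
           else (t ^+ j) x \in porbit t' x.
  by have := H i; rewrite -yE (negbTE yu).
elim: j => [|j]; first by rewrite expg0 perm1 (negbTE xu) porbit_id.
rewrite expgSr permM; set z := (t ^+ j) x.
have [->|zu] := eqVneq z u.
  have [tu|tu] := eqVneq (t u) u.
    by case/eqP: ku; apply: (@perm_inj _ t); rewrite tu.
  by move=> /(memS t'); rewrite t'k.
have [->|zk] := eqVneq z k; first by rewrite -/u eqxx.
move=> /(memS t'); rewrite t'E //; case: eqP => // tzu.
by case/eqP: zk; apply: (@perm_inj _ t).
Qed.

Lemma porbit_fixed t x y : t x = x -> (y \in porbit t x) = (y == x).
Proof.
move=> tx; apply/porbitP/eqP => [[i ->]|->]; last by exists 0; rewrite expg0 perm1.
by elim: i => [|i IH]; rewrite ?expg0 ?perm1 // expgSr permM IH.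
Qed.

Lemma porbit_skipE t k x : k != t k ->
  porbit (tperm k (t k) * t) x =
    if x == t k then [set t k] else porbit t x :\ t k.
Proof.
move=> ku; have fixu : porbit (tperm k (t k) * t) (t k) = [set t k].
  by apply/setP => y; rewrite inE porbit_fixed // permM tpermR.
have [->//|xu] := eqVneq; apply/setP => y; rewrite !inE.
have [->|yu] /= := eqVneq; last exact: porbit_skip.
by rewrite porbit_sym fixu inE (negbTE xu).
Qed.

Lemma porbits_skip t k : k != t k ->
  porbits (tperm k (t k) * t) =
    [set t k] |: ((porbit t k :\ t k) |: (porbits t :\ porbit t k)).
Proof.
move=> ku; apply/setP => V; rewrite !inE.
have pk : porbit t (t k) = porbit t k.
  by apply/eqP; rewrite eq_porbit_mem (mem_porbit t 1).
apply/imsetP/idP => [[x _ ->]|/or3P[/eqP->|/eqP->|/andP[Vk /imsetP[x _ Vx]]]].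
- rewrite porbit_skipE //; have [_|xu] := eqVneq x; first by rewrite eqxx.
  have [->|nk] := eqVneq (porbit t x) (porbit t k); first by rewrite eqxx orbT.
  suff -> : porbit t x :\ t k = porbit t x.
    by rewrite nk imset_f ?orbT.
  apply/setP => y; rewrite !inE; case: eqP => //= ->.
  by rewrite porbit_sym pk; apply/esym/negP; rewrite -eq_porbit_mem (negbTE nk).
- by exists (t k); rewrite // porbit_skipE // eqxx.
- by exists k; rewrite // porbit_skipE // (negbTE ku).
- have xk : x \notin porbit t k by rewrite -eq_porbit_mem -Vx.
  exists x => //; rewrite porbit_skipE //; case: eqP => [xu|_].
    by case/negP: xk; rewrite xu (mem_porbit t 1).
  rewrite Vx; apply/setP => y; rewrite !inE; case: eqP => //= ->.
  by rewrite porbit_sym pk (negbTE xk).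
Qed.

(** Leaving out t k raises #(t) by one and lowers #(t^-1 g) by at most one; the genus bound for the
    new permutation then forces equality. *)
Lemma geodesic_skip g t k : k != t k -> geodesic g t ->
  geodesic g (tperm k (t k) * t).
Proof.
set u := t k; set t' := _ * t => ku /eqP geo.
have ct' : #|porbits t'| = #|porbits t|.+1.
  by rewrite card_porbits_split // (mem_porbit t 1).
have le1 : #|porbits (t^-1 * g)| <= #|porbits (t'^-1 * g)|.+1.
  have -> : t^-1 * g = t'^-1 * g * tperm (g k) (g u).
    by rewrite /t' invMg tpermV -tpermJ -!mulgA mulKVg tpermKg.
  rewrite card_porbits_mulC_tperm.
  by rewrite -(porbitsV (t'^-1 * g)) card_porbits_tperm_le.
have := genus_bound g t'; rewrite /geodesic -geo ct' addnS -addSn leq_add2r => le2.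
by rewrite eqn_add2r eqn_leq le1 le2.
Qed.

Lemma mem_porbit_trans s x y z :
  y \in porbit s x -> z \in porbit s y -> z \in porbit s x.
Proof. by rewrite -eq_porbit_mem porbit_sym -eq_porbit_mem => /eqP<- /eqP->; exact: porbit_id. Qed.

End Geodesics.

(** * Geodesics from 1 to the full cycle and noncrossing partitions *)

Section Noncrossing.
Variable p : nat.
Local Open Scope group_scope.
Implicit Types (t : {perm 'I_p}) (i j k l x y z : 'I_p) (e : rel 'I_p).

Definition ord_cycle : {perm 'I_p} := perm (@ordS_inj p).
Local Notation g := ord_cycle.

Lemma ord_cycleE i j : i < j -> val (g i) = i.+1.
Proof. by move=> ij; rewrite permE /= modn_small // (leq_ltn_trans ij). Qed.

(** At a fixed point z of t, t^-1 g acts as g, and g z = z + 1 as long as z < y; the end point y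
    itself may be moved. *)
Lemma ord_cycle_walk t x y : x <= y ->
  (forall z, x <= z < y -> t z = z) -> y \in porbit (t^-1 * g) x.
Proof.
have [n] := ubnP (y - x); elim: n => // n IH in x *.
rewrite ltnS => yx; rewrite leq_eqVlt => /predU1P[/val_inj->|xy fix_t].
  by rewrite porbit_id.
have gx := ord_cycleE xy; have tx : t x = x by rewrite fix_t // leqnn.
apply: (@mem_porbit_trans _ _ _ (g x)).
  by rewrite -[X in g X](permK t) tx -permM (mem_porbit _ 1).
apply: IH; rewrite ?gx //; first by rewrite subnS prednK // subn_gt0.
by move=> z /andP[xz zy]; rewrite fix_t // (ltnW xz).
Qed.

Definition noncrossing_rel e :=
  forall i j k l, i < j -> j < k -> k < l -> e i k -> e j l -> e i j.

(** Suppose i, k and j, l lie in two different cycles. Every other moved point can be skipped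
    without leaving the geodesics or changing which of the four points share a cycle. What remains
    is (i k)(j l), which violates transversality. *)
Lemma geodesic_noncrossing t : geodesic g t ->
  noncrossing_rel (fun x y => y \in porbit t x).
Proof.
move=> + i j k l ij jk kl.
have [n] := ubnP (#|'I_p| - #|porbits t|); elim: n => // n IH in t *.
move=> Hn geo tik tjl; apply/negPn/negP => tij.
have [ik jl] : i != k /\ j != l.
  by split; apply/eqP=> eq; [move: jk; rewrite -eq ltnNge (ltnW ij)
                            |move: kl; rewrite -eq ltnNge (ltnW jk)].
have til : l \notin porbit t i.
  by apply: contra tij => til; apply: mem_porbit_trans til _; rewrite porbit_sym.
have tkj : j \notin porbit t k.
  by apply: contra tij; exact: mem_porbit_trans.
have tkl : l \notin porbit t k.
  by apply: contra til; exact: mem_porbit_trans.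
have t1 x : t x \in porbit t x by exact: (mem_porbit t 1).
have [/existsP[x /andP[tx xn]]|] :=
    boolP [exists x, (t x != x) && (x \notin [:: i; j; k; l])].
  pose y := t^-1 x; have ty : t y = x by rewrite permKV.
  have yx : y != t y.
    by rewrite ty; apply: contra tx => /eqP xy; rewrite -{1}xy ty.
  move: xn; rewrite !inE !negb_or => /and4P[xi xj xk xl].
  have geo' := geodesic_skip yx geo.
  case/negP: tij; rewrite -(porbit_skip yx); try by rewrite ty eq_sym.
  rewrite !ty in geo' *; apply: IH geo' _ _.
  - have := card_porbits_le (tperm y x * t).
    rewrite -{1 2}ty card_porbits_split // => le.
    exact: ltn_subS Hn le.
  - by rewrite -{1}ty porbit_skip // ty eq_sym.
  - by rewrite -{1}ty porbit_skip // ty eq_sym.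
rewrite negb_exists => /forallP fixt.
have fix_t x : x != i -> x != j -> x != k -> x != l -> t x = x.
  move=> xi xj xk xl; apply/eqP; have := fixt x.
  by rewrite negb_and negbK !inE !negb_or xi xj xk xl orbF.
have moved x y : x != y -> y \in porbit t x -> t x != x.
  by move=> xy; apply: contraL => /eqP/porbit_fixed ->; rewrite eq_sym.
have tE x y : x != y -> y \in porbit t x -> t x = y \/
    t x \in [seq z <- [:: i; j; k; l] | (z != x) && (z != y)].
  move=> xy /(moved _ _ xy) tx; have [|txy] := eqVneq (t x) y; [by left|right].
  have := fixt (t x); rewrite negb_and !negbK mem_filter tx txy (inj_eq perm_inj).
  by rewrite (negbTE tx).
have ti : t i = k.
  have [//|] := tE i k ik tik; rewrite mem_filter !inE => /andP[/andP[/negbTE ne1 /negbTE ne2]].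
  rewrite ne1 ne2 /= => /orP[] /eqP tii'.
    by case/negP: tij; rewrite -tii'.
  by case/negP: til; rewrite -tii'.
have tk : t k = i.
  have tki : i \in porbit t k by rewrite porbit_sym.
  have ki : k != i by rewrite eq_sym.
  have [//|] := tE k i ki tki; rewrite mem_filter !inE => /andP[/andP[/negbTE ne1 /negbTE ne2]].
  rewrite ne1 ne2 /= => /orP[] /eqP tkk'.
    by case/negP: tkj; rewrite -tkk'.
  by case/negP: tkl; rewrite -tkk'.
have tji : i \notin porbit t j by rewrite porbit_sym.
have tjk : k \notin porbit t j by rewrite porbit_sym.
have tli : i \notin porbit t l by rewrite porbit_sym.
have tlk : k \notin porbit t l by rewrite porbit_sym.
have tj : t j = l.
  have [//|] := tE j l jl tjl; rewrite mem_filter !inE => /andP[/andP[/negbTE ne1 /negbTE ne2]].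
  rewrite ne1 ne2 !orbF => /orP[] /eqP tii'.
    by case/negP: tji; rewrite -tii'.
  by case/negP: tjk; rewrite -tii'.
have tl : t l = j.
  have tlj : j \in porbit t l by rewrite porbit_sym.
  have lj : l != j by rewrite eq_sym.
  have [//|] := tE l j lj tlj; rewrite mem_filter !inE => /andP[/andP[/negbTE ne1 /negbTE ne2]].
  rewrite ne1 ne2 !orbF => /orP[] /eqP tii'.
    by case/negP: tli; rewrite -tii'.
  by case/negP: tlk; rewrite -tii'.
(* Now t = (i k)(j l), so t^-1 g has the walk
   i -> k + 1 -> ... -> l -> j + 1 -> ... -> k. *)
case/eqP: ik; apply: (geodesic_transverse geo tik).
have step x y : t y = x -> g y \in porbit (t^-1 * g) x.
  by move=> tx; rewrite -[X in g X](permK t) tx -permM (mem_porbit _ 1).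
apply: mem_porbit_trans (step _ _ tk) _.
apply: (@mem_porbit_trans _ _ _ l).
  apply: ord_cycle_walk; rewrite (ord_cycleE kl) // => z /andP[kz zl].
  by apply: fix_t; apply/eqP => eq; subst z; clear -ij jk kl kz zl; lia.
apply: mem_porbit_trans (step _ _ tj) _.
apply: ord_cycle_walk; rewrite (ord_cycleE jk) // => z /andP[kz zl].
by apply: fix_t; apply/eqP => eq; subst z; clear -ij jk kl kz zl; lia.
Qed.

(** Equivalent i < j at minimal distance will do. Let z between them be equivalent to some w <> z.
    If w is also strictly between them, minimality fails; otherwise z is equivalent to i, by
    noncrossing if w is outside [i, j], and minimality fails again. *)
Lemma noncrossing_min_pair e : equivalence_rel e -> noncrossing_rel e ->
  (exists x y, x != y /\ e x y) ->
  exists i j, [/\ i < j, e i j & forall z w, i < z < j -> e z w -> w = z].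
Proof.
move=> equiv nc [x [y [xy exy]]].
have exx a : e a a by have [] := equiv a a a.
have esym a b : e a b = e b a.
  by apply/idP/idP => H; [have [_ /(_ H) <-] := equiv a b a
                        |have [_ /(_ H) <-] := equiv b a b].
have etr a b c : e a b -> e b c -> e a c.
  by move=> ab; have [_ /(_ ab) ->] := equiv a b c.
pose Q (n : nat) := [exists i : 'I_p, exists j : 'I_p, [&& i < j, j - i == n & e i j]].
have exQ : exists n, Q n.
  wlog xy' : x y xy exy / x < y => [H|].
    case: (ltngtP x y) => xy'; first exact: H xy'.
      by apply: (H y x) => //; rewrite ?(eq_sym y) ?(esym y).
    by move: xy; rewrite -val_eqE /= xy' eqxx.
  by exists (y - x); apply/existsP; exists x; apply/existsP; exists y; rewrite xy' eqxx.
have [i [j [ij eij minij]]] : exists i j, [/\ i < j, e i j &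
    forall a b : 'I_p, a < b -> e a b -> j - i <= b - a].
  case: (ex_minnP exQ) => n /existsP[i /existsP[j /and3P[ij /eqP jin eij]]] min.
  exists i, j; split=> // a b ab eab; rewrite jin; apply: min.
  by apply/existsP; exists a; apply/existsP; exists b; rewrite ab eqxx.
exists i, j; split=> // z w /andP[iz zj] ezw.
have eiz : ~ e i z by move=> /(minij _ _ iz); clear -iz zj; lia.
have ewz : e w z by rewrite esym.
have [wi|iw|/val_inj wi] := ltngtP w i.
- by case: eiz; rewrite esym; apply: etr (nc _ _ _ _ wi iz zj ewz eij); rewrite esym.
- have [wj|jw|/val_inj wj] := ltngtP w j.
  + have [wz|zw|/val_inj//] := ltngtP w z.
      by have := minij _ _ wz ewz; clear -wz wj iw iz zj; lia.
    by have := minij _ _ zw ezw; clear -zw wj iw iz zj; lia.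
  + by case: eiz; exact: (nc _ _ _ _ iz zj jw).
  + by case: eiz; apply: etr eij _; rewrite -wj.
- by case: eiz; rewrite -wi.
Qed.

Definition porbit_rel t : rel 'I_p := fun x y => y \in porbit t x.

Lemma porbit_rel_equiv t : equivalence_rel (porbit_rel t).
Proof.
move=> x y z; rewrite /porbit_rel porbit_id; split=> //.
by rewrite porbit_sym -eq_porbit_mem => /eqP->.
Qed.

Lemma ord_cycle_transport t i j : i < j ->
  (forall z, i < z < j -> t z = z) -> j \in porbit (t^-1 * g) (t i).
Proof.
move=> ij fixt; apply: (@mem_porbit_trans _ _ _ (g i)).
  by rewrite -[X in g X](permK t) -permM (mem_porbit _ 1).
by apply: ord_cycle_walk; rewrite (ord_cycleE ij).
Qed.

(** No point strictly between i and j is moved, so t^-1 g leads from t i to i + 1 and on to j. Thus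
    t i and j share a cycle of t and a cycle of t^-1 g, and transversality identifies them. *)
Lemma geodesic_next t i j : geodesic g t -> i < j -> j \in porbit t i ->
  (forall z, i < z < j -> t z = z) -> t i = j.
Proof.
move=> geo ij tij fixt; apply: (geodesic_transverse geo).
  by apply: mem_porbit_trans tij; rewrite porbit_sym (mem_porbit t 1).
exact: ord_cycle_transport.
Qed.

(** A minimal pair i < j of the common cycle partition has all points in between fixed by both
    permutations, which forces t1 i = j = t2 i. Leaving j out of both keeps the partitions equal and
    adds a cycle. *)
Lemma geodesic_inj t1 t2 : geodesic g t1 -> geodesic g t2 ->
  porbit_rel t1 =2 porbit_rel t2 -> t1 = t2.
Proof.
have [n] := ubnP (#|'I_p| - #|porbits t1|); elim: n => // n IH in t1 t2 *.
move=> Hn geo1 geo2 t12.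
have [/existsP[x /existsP[y /andP[xy txy]]]|] :=
    boolP [exists x, exists y, (x != y) && porbit_rel t1 x y]; last first.
  rewrite negb_exists => /forallP triv; apply/permP => x.
  have /existsPn {}triv := triv x.
  have tx (t : {perm 'I_p}) : porbit_rel t1 =2 porbit_rel t -> t x = x.
    move=> t1t; have := triv (t x); rewrite t1t /porbit_rel (mem_porbit t 1) andbT.
    by rewrite negbK => /eqP<-.
  by rewrite !tx.
have [i [j [ij tij fixt]]] : exists i j, [/\ i < j, porbit_rel t1 i j &
    forall z w, i < z < j -> porbit_rel t1 z w -> w = z].
  apply: noncrossing_min_pair (porbit_rel_equiv t1) (geodesic_noncrossing geo1) _.
  by exists x, y.
have t1i : t1 i = j.
  by apply: geodesic_next => // z /fixt; apply; apply: (mem_porbit t1 1).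
have t2i : t2 i = j.
  apply: geodesic_next => //; first by move: tij; rewrite t12.
  by move=> z /fixt; apply; rewrite t12; apply: (mem_porbit t2 1).
have ij' : i != j by rewrite neq_ltn ij.
have [it1 it2] : i != t1 i /\ i != t2 i by rewrite t1i t2i.
apply: (mulgI (tperm i j)); apply: IH.
- have := card_porbits_le (tperm i j * t1); rewrite card_porbits_split //.
  exact: ltn_subS Hn.
- by rewrite -t1i; exact: geodesic_skip.
- by rewrite -t2i; exact: geodesic_skip.
- move=> a b; rewrite /porbit_rel -{1}t1i -t2i !porbit_skipE // t1i t2i.
  by case: ifP => // _; rewrite !inE; have := t12 a b; rewrite /porbit_rel => ->.
Qed.

(** Induction on the number of related pairs: the point j of a minimal pair i < j is isolated, and
    then reinserted right after i in the permutation obtained. *)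
Lemma noncrossing_geodesic e : equivalence_rel e -> noncrossing_rel e ->
  exists2 t, geodesic g t & porbit_rel t =2 e.
Proof.
have [n] := ubnP #|[set xy | e xy.1 xy.2]|; elim: n => // n IH in e *.
move=> Hn equiv nc.
have exx a : e a a by have [] := equiv a a a.
have [/existsP[x /existsP[y /andP[xy exy]]]|] :=
    boolP [exists x, exists y, (x != y) && e x y]; last first.
  rewrite negb_exists => /forallP triv; exists 1.
    by rewrite /geodesic invg1 mul1g card_porbits1 addnC.
  move=> x y; have /existsPn/(_ y) := triv x.
  rewrite /porbit_rel porbit_fixed ?perm1 // eq_sym.
  by case: eqVneq => [->|_] /=; [rewrite exx|case: (e x y)].
have [i [j [ij eij fixt]]] : exists i j, [/\ i < j, e i j &
    forall z w, i < z < j -> e z w -> w = z].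
  by apply: noncrossing_min_pair => //; exists x, y.
have ij' : i != j by rewrite neq_ltn ij.
pose e' : rel 'I_p := fun a b => (a == b) || [&& a != j, b != j & e a b].
have e'e a b : e' a b -> e a b by case/predU1P => [->|/and3P[]].
have esym a b : e a b = e b a.
  by apply/idP/idP => H; [have [_ /(_ H) <-] := equiv a b a
                        |have [_ /(_ H) <-] := equiv b a b].
have etr a b c : e a b -> e b c = e a c.
  by move=> ab; have [_ /(_ ab) ->] := equiv a b c.
have e'j a : e' a j = (a == j) by rewrite /e' eqxx andbF orbF.
have ej' a : e' j a = (a == j) by rewrite /e' eqxx /= orbF eq_sym.
have e'E a b : a != j -> b != j -> e' a b = e a b.
  by move=> aj bj; rewrite /e' aj bj /=; case: eqVneq => // ->; rewrite exx.
have equiv' : equivalence_rel e'.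
  move=> a b c; split; first by rewrite /e' eqxx.
  case/predU1P => [->//|/and3P[aj bj ab]].
  have [->|cj] := eqVneq c j; first by rewrite !e'j (negbTE aj) (negbTE bj).
  by rewrite !e'E // (etr _ _ _ ab).
have [| | |t' geo' t'e'] := IH e'; [|exact: equiv'| |].
- rewrite ltnS in Hn; apply: leq_trans Hn; apply: proper_card; apply/properP.
  split; first by apply/fintype.subsetP => -[a b]; rewrite !inE /=; exact: e'e.
  by exists (i, j); rewrite !inE //= e'j.
- move=> a b c d ab bc cd ac bd.
  have ac' : a != c by rewrite neq_ltn (ltn_trans ab bc).
  have bd' : b != d by rewrite neq_ltn (ltn_trans bc cd).
  have eab := nc _ _ _ _ ab bc cd (e'e _ _ ac) (e'e _ _ bd).
  rewrite e'E //.
    by apply: contraNneq ac' => aj; move: ac; rewrite aj ej' eq_sym.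
  by apply: contraNneq bd' => aj; move: bd; rewrite aj ej' eq_sym.
have t'x a b : (b \in porbit t' a) = e' a b by exact: t'e'.
have t'fix z : (forall w, e' z w -> w = z) -> t' z = z.
  by apply; rewrite -t'x (mem_porbit t' 1).
have t'j : t' j = j by apply: t'fix => w; rewrite ej' => /eqP.
pose t := tperm i j * t'.
have ti : t i = j by rewrite permM tpermL.
have tt' : t' = tperm i (t i) * t by rewrite ti mulgA tperm2 mul1g.
have iti : i != t i by rewrite ti.
exists t.
  have ct : #|porbits t'| = #|porbits t|.+1.
    by rewrite tt' card_porbits_split // (mem_porbit t 1).
  (* Points strictly between i and j being fixed, t'^-1 g walks from g i to j and then to g j, so
     the transposition of g i and g j splits this cycle. The gain offsets the cycle of t lost by
     reinserting j. *)
  have cg : #|porbits (t^-1 * g)| = #|porbits (t'^-1 * g)|.+1.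
    have -> : t^-1 * g = t'^-1 * g * tperm (g i) (g j).
      by rewrite /t invMg tpermV -tpermJ -!mulgA mulKVg.
    rewrite card_porbits_mulC_tperm card_porbits_split ?(inj_eq perm_inj) //.
      by rewrite porbitsV.
    rewrite porbitV; apply: (@mem_porbit_trans _ _ _ j).
      apply: ord_cycle_walk; rewrite (ord_cycleE ij) // => z /andP[iz zj].
      by apply: t'fix => w /e'e; apply: fixt; rewrite iz.
    have -> : g j = (t'^-1 * g) j by rewrite permM -{2}t'j permK.
    exact: (mem_porbit _ 1).
  by move/eqP: geo'; rewrite /geodesic ct addnS -addSn -cg => /eqP.
have txy a b : a != j -> b != j -> (b \in porbit t a) = e a b.
  move=> aj bj; rewrite -e'E // -t'x tt' porbit_skip ?ti //.
have tij a : (j \in porbit t a) = (i \in porbit t a).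
  rewrite ![_ \in porbit t a]porbit_sym -!eq_porbit_mem.
  suff -> : porbit t i = porbit t j by [].
  by apply/eqP; rewrite -ti eq_porbit_mem porbit_sym (mem_porbit t 1).
have eij' a : e a j = e a i by rewrite !(esym a) (etr i j) // esym.
have main a b : a != j -> porbit_rel t a b = e a b.
  rewrite /porbit_rel => aj; have [->|bj] := eqVneq b j; last exact: txy.
  by rewrite tij eij' txy.
move=> a b; have [->|aj] := eqVneq a j; last exact: main.
have [->|bj] := eqVneq b j; first by rewrite /porbit_rel porbit_id exx.
by rewrite /porbit_rel porbit_sym esym; exact: main.
Qed.

End Noncrossing.

(** * Peeling points off a geodesic *)

Section Peeling.
Variable T : finType.
Implicit Types (g t s : {perm T}).
Local Open Scope group_scope.

Lemma porbits_partition s : finset.partition (porbits s) [set: T].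
Proof.
have -> : porbits s = equivalence_partition (fun x y => y \in porbit s x) [set: T].
  apply/setP => V; apply/imsetP/imsetP => -[x _ ->]; exists x => //.
    by apply/setP => y; rewrite !inE.
  by apply/setP => y; rewrite !inE.
apply: equivalence_partitionP => x y z _ _ _; rewrite porbit_id; split=> //.
by rewrite porbit_sym -eq_porbit_mem => /eqP->.
Qed.

Definition fixed_points s := [set x | s x == x].

Lemma fixed_pointsP s x : reflect (porbit s x = [set x]) (x \in fixed_points s).
Proof.
rewrite inE; apply: (iffP eqP) => [sx|px].
  by apply/setP => y; rewrite porbit_fixed // inE.
by have := mem_porbit s 1 x; rewrite px inE expg1 => /eqP.
Qed.

(** A cycle V contributes 2 on the left and |V|, plus one if V is a singleton, on the right. *)
Lemma card_porbits_fixed s : #|porbits s|.*2 <= #|T| + #|fixed_points s|.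
Proof.
rewrite -cardsT (card_partition (porbits_partition s)).
have -> : #|porbits s|.*2 = \sum_(V in porbits s) 2 by rewrite sum_nat_const muln2.
have le1 : \sum_(V in porbits s) (#|V| == 1 : nat) <= #|fixed_points s|.
  rewrite -big_mkcondr /= sum1dep_card.
  rewrite -(card_imset _ (@set1_inj T)); apply: subset_leq_card.
  apply/fintype.subsetP => V; rewrite inE => /andP[/imsetP[x _ ->] /cards1P[y xy]].
  have yx : y = x by have := porbit_id s x; rewrite xy inE => /eqP.
  by rewrite xy yx imset_f //; apply/fixed_pointsP; rewrite xy yx.
apply: leq_trans (leq_add (leqnn _) le1); rewrite -big_split /=.
apply: leq_sum => V /imsetP[x _ ->]; have := card_porbit_neq0 s x.
by case: #|_| => [|[|n]] //=; rewrite addn0.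
Qed.

Lemma card_porbits_gt_fixed s : s != 1 -> #|fixed_points s| < #|porbits s|.
Proof.
move=> s1; have [x sx] : exists x, s x != x.
  apply/existsP; rewrite -negb_forall; apply: contra s1 => /forallP H.
  by apply/eqP/permP => x; rewrite perm1 (eqP (H x)).
rewrite -(card_imset _ (@set1_inj T)); apply: proper_card; apply/properP; split.
  by apply/fintype.subsetP => V /imsetP[y /fixed_pointsP<- ->]; exact: imset_f.
exists (porbit s x); first exact: imset_f.
apply/negP => /imsetP[y _ xy]; have yx := porbit_id s x.
move: yx (mem_porbit s 1 x); rewrite xy !inE expg1 => /eqP<- /eqP sxx.
by rewrite sxx eqxx in sx.
Qed.

(** The hypothesis amounts to #(t) = #T. A permutation other than 1 has fewer fixed points than
    cycles, which contradicts the bound of 2 #(t) by #T plus the number of fixed points. *)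
Lemma geodesic1 t : geodesic 1 t -> t = 1.
Proof.
rewrite /geodesic mulg1 porbitsV card_porbits1 => geo.
apply/eqP/negPn/negP => /card_porbits_gt_fixed.
have := card_porbits_fixed t; have := card_porbits_le t.
move/eqP: geo; set a := #|porbits t|; set b := #|fixed_points t|; set c := #|T|.
lia.
Qed.

(* If there is no such k, then t and t^-1 g have at most as many fixed points as
   g. As a permutation has at most (#|T| + #fixed points) / 2 cycles, this gives
   #(t) + #(t^-1 g) <= #|T| + #fixed points of g < #|T| + #(g). *)
Lemma geodesic_peel g t : geodesic g t -> g != 1 ->
  exists2 k, g k != k & t k = k \/ t k = g k.
Proof.
move=> /eqP geo g1; set F := fixed_points g.
suff /existsP[k /andP[gk /orP[/eqP tk|/eqP tk]]] :
    [exists k, (g k != k) && ((t k == k) || (t k == g k))] by exists k; auto.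
apply: contraT; rewrite negb_exists => /forallP H; exfalso.
have le1 : #|fixed_points t| <= #|F|.
  apply: subset_leq_card; apply/fintype.subsetP => x; rewrite !inE => /eqP tx.
  by have := H x; rewrite tx eqxx andbT negbK.
have le2 : #|fixed_points (t^-1 * g)| <= #|F|.
  rewrite -(card_preimset F (@perm_inj _ t^-1)).
  apply: subset_leq_card; apply/fintype.subsetP => x; rewrite !inE permM.
  set k := t^-1 x => /eqP gk; have := H k.
  have tk : t k = x by rewrite permKV.
  by rewrite tk gk eqxx orbT andbT negbK => /eqP ->.
have := card_porbits_fixed t; have := card_porbits_fixed (t^-1 * g).
have := card_porbits_gt_fixed g1; move: geo le1 le2; rewrite -/F.
move: #|porbits t| #|porbits g| #|porbits _| #|fixed_points t| #|fixed_points _| #|F| #|T|.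
by move=> a b c d e f h; lia.
Qed.

(** Removing the fixed point g y of t from its cycle of g multiplies t^-1 g by the transposition of
    t y and g y. As t^-1 g sends t y to g y, this splits a cycle, and both sides of the equality
    grow by one. *)
Lemma geodesic_skip_fixed g t y : y != g y -> t (g y) = g y -> geodesic g t ->
  geodesic (tperm y (g y) * g) t.
Proof.
move=> yg tg; rewrite /geodesic => /eqP geo.
rewrite [in X in _ == X]card_porbits_split // ?(mem_porbit g 1) //.
have -> : t^-1 * (tperm y (g y) * g) = tperm (t y) (g y) * (t^-1 * g).
  by rewrite -[in RHS]tg -tpermJ /conjg -!mulgA mulKVg.
rewrite card_porbits_split.
- by rewrite addSn addnS geo.
- by rewrite -{1}tg (inj_eq perm_inj).
- rewrite -{1}(permK t y) -(permM _ g).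
  by exact: (mem_porbit _ 1).
Qed.

(** The product t^-1 g is unchanged, while #(t) and #(g) both grow by one. *)
Lemma geodesic_skip_both g t k : k != g k -> t k = g k -> geodesic g t ->
  geodesic (tperm k (g k) * g) (tperm k (g k) * t).
Proof.
move=> kg tk; rewrite /geodesic => /eqP geo.
have -> : (tperm k (g k) * t)^-1 * (tperm k (g k) * g) = t^-1 * g.
  by rewrite invMg -mulgA mulKg.
rewrite !card_porbits_split // ?addnS ?geo // ?(mem_porbit g 1) //.
by rewrite -tk (mem_porbit t 1).
Qed.

End Peeling.

(** * Contractions of matrix powers along two permutations *)

Section TensorContraction.
Local Open Scope ring_scope.
Variables (T A B : finType) (K : fieldType).
Variables (L : nat -> A * B -> A * B -> K) (lam : nat -> K).
Hypothesis L0 : forall x y, L 0 x y = (x == y)%:R.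
Hypothesis LD : forall i j x z, L (i + j) x z = \sum_y L i x y * L j y z.
Hypothesis L_trace : forall l y z, \sum_x L l (x, y) (x, z) = lam l *+ (y == z).
Hypothesis A_neq0 : #|A|%:R != 0 :> K.
Hypothesis B_neq0 : #|B|%:R != 0 :> K.
Implicit Types (g t : {perm T}) (l : T -> nat).

Definition upd (C : Type) (k : T) (f : {ffun T -> C}) (x : C) : {ffun T -> C} :=
  [ffun j => if j == k then x else f j].

(** Resampling at k: (f, x) -> (f with value x at k, f k) is an involution. The factor #C counts the
    old values at k. *)
Lemma sum_upd (C : finType) (k : T) (F : {ffun T -> C} -> K) :
  #|C|%:R * \sum_f F f = \sum_f \sum_x F (upd k f x).
Proof.
rewrite pair_big /= (reindex (fun fx => (upd k fx.1 fx.2, fx.1 k))) /=; last first.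
  have inv : involutive (fun fx : {ffun T -> C} * C => (upd k fx.1 fx.2, fx.1 k)).
    move=> [f x] /=; rewrite ffunE eqxx; congr pair; apply/ffunP => j.
    by rewrite !ffunE; case: eqP => // ->.
  by apply: onW_bij; exact: inv_bij.
rewrite -(pair_big xpredT xpredT (fun f x => F (upd k (upd k f x) (f k)))) /=.
rewrite big_distrr /=; apply: eq_bigr => f _.
rewrite (eq_bigr (fun=> F f)) ?sumr_const ?mulr_natl // => x _.
by congr F; apply/ffunP => j; rewrite !ffunE; case: eqP => // ->.
Qed.

(** By [L0] and [LD] the family [L] consists of the powers of one matrix on a tensor product with
    legs indexed by A and B. The copy at k is joined to the copy at t k through the first leg and to
    the copy at g k through the second. *)
Definition tensor_contraction g t l : K :=
  \sum_(a : {ffun T -> A}) \sum_(b : {ffun T -> B})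
    \prod_k L (l k) (a k, b k) (a (t k), b (g k)).

Lemma sum_upd2 (k : T) (F : {ffun T -> A} -> {ffun T -> B} -> K) :
  #|A|%:R * #|B|%:R * (\sum_a \sum_b F a b) =
  \sum_a \sum_b \sum_x \sum_y F (upd k a x) (upd k b y).
Proof.
rewrite mulrAC (sum_upd k) mulr_suml; apply: eq_bigr => a _.
rewrite mulr_suml [RHS]exchange_big /=; apply: eq_bigr => x _.
by rewrite mulrC (sum_upd k).
Qed.

Lemma lam0 : lam 0 = #|A|%:R.
Proof.
have /card_gt0P[y _] : (0 < #|B|)%N by rewrite lt0n; apply: contraNneq B_neq0 => ->.
have := L_trace 0 y y; rewrite eqxx mulr1n => <-.
rewrite (eq_bigr (fun=> 1)); first by rewrite sumr_const.
by move=> x _; rewrite L0 eqxx.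
Qed.

(* Division-free forms of the two removals: the summation over the leg indices
   at k costs the factor #|A| * #|B|, and k survives as a fixed point of both
   permutations carrying L 0. *)
Lemma contraction_skip_fixed g t l k : g k != k -> t k = k ->
  let y := (g^-1)%g k in
  let l' := fun j => if j == k then 0%N else l j in
  #|A|%:R * #|B|%:R * tensor_contraction g t l =
    lam (l k) * tensor_contraction (tperm y (g y) * g)%g t l'.
Proof.
move=> gk tk y l'; rewrite (sum_upd2 k) mulr_sumr; apply: eq_bigr => a _.
rewrite mulr_sumr; apply: eq_bigr => b _.
have gy : g y = k by rewrite permKV.
have ky : k != y by apply: contra gk => /eqP {1}->; rewrite gy.
pose H z := \prod_(j | j != k) L (l j) (a j, b j) (a (t j), upd k b z (g j)).
transitivity (\sum_z \sum_x L (l k) (x, z) (x, b (g k)) * H z).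
  rewrite exchange_big; apply: eq_bigr => z _; apply: eq_bigr => x _.
  rewrite (bigD1 k) //= !ffunE eqxx tk eqxx (negbTE gk); congr (_ * _).
  apply: eq_bigr => j jk; rewrite !ffunE (negbTE jk).
  by rewrite -{1}tk (inj_eq perm_inj) (negbTE jk).
(* As t fixes k, the sum over x is a partial trace over the first leg, which is scalar and forces z
   = b (g k). *)
transitivity (lam (l k) * H (b (g k))).
  rewrite (bigD1 (b (g k))) //= -mulr_suml L_trace eqxx mulr1n big1 ?addr0 //.
  by move=> z /negbTE zg; rewrite -mulr_suml L_trace zg mul0r.
congr (_ * _); rewrite (bigD1 k) //= {1}/l' eqxx L0 tk permM gy tpermR gy eqxx mul1r.
apply: eq_bigr => j jk; rewrite /l' (negbTE jk) ffunE permM.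
have [->|jy] := eqVneq j y; first by rewrite gy eqxx tpermL.
by rewrite -gy (inj_eq perm_inj) (negbTE jy) tpermD 1?eq_sym // gy.
Qed.

Lemma contraction_skip_both g t l k : k != g k -> t k = g k ->
  let l' := fun j => if j == g k then 0%N else if j == k then (l k + l (g k))%N
                     else l j in
  #|A|%:R * #|B|%:R * tensor_contraction g t l =
    tensor_contraction (tperm k (g k) * g)%g (tperm k (g k) * t)%g l'.
Proof.
move=> kg tk l'; rewrite (sum_upd2 (g k)); apply: eq_bigr => a _.
apply: eq_bigr => b _; set u := g k in kg tk l' *.
have uk : u != k by rewrite eq_sym.
have tu : t u != u by rewrite -{2}tk (inj_eq perm_inj).
have gu : g u != u by rewrite -[X in _ != X]/(g k) (inj_eq perm_inj).
pose H := \prod_(j | (j != u) && (j != k)) L (l j) (a j, b j) (a (t j), b (g j)).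
transitivity (\sum_x \sum_z L (l k) (a k, b k) (x, z) * L (l u) (x, z) (a (t u), b (g u)) * H).
  apply: eq_bigr => x _; apply: eq_bigr => z _.
  rewrite (bigD1 u) //= (bigD1 k) ?kg //= !ffunE eqxx (negbTE tu) (negbTE gu).
  rewrite (negbTE kg) tk -/u eqxx mulrA [L (l u) _ _ * _]mulrC; congr (_ * _).
  apply: eq_bigr => j /andP[ju jk]; rewrite !ffunE (negbTE ju) -{1}tk.
  by rewrite -[X in g j == X]/(g k) !(inj_eq perm_inj) (negbTE jk).
rewrite pair_big /= -mulr_suml.
(* The copies at k and g k are joined along both legs, so the sum over their common index is a
   matrix product and the exponents add up. *)
have -> : \sum_(i : A * B) L (l k) (a k, b k) (i.1, i.2) *
    L (l u) (i.1, i.2) (a (t u), b (g u)) = L (l k + l u) (a k, b k) (a (t u), b (g u)).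
  by rewrite LD; apply: eq_bigr => -[].
rewrite [RHS](bigD1 u) //= {1}/l' eqxx L0 !permM !tpermR tk -/u eqxx mul1r.
rewrite [RHS](bigD1 k) ?kg //= {1}/l' (negbTE kg) eqxx !permM !tpermL; congr (_ * _).
apply: eq_bigr => j /andP[ju jk]; rewrite /l' (negbTE ju) (negbTE jk) !permM.
by rewrite tpermD 1?eq_sym.
Qed.

Lemma big_porbits_skip (F : {set T} -> K) t k : k != t k ->
  \prod_(V in porbits (tperm k (t k) * t)%g) F V =
    F [set t k] * (F (porbit t k :\ t k) *
      \prod_(V in porbits t :\ porbit t k) F V).
Proof.
move=> kt; rewrite porbits_skip //.
have mem_orbit V x : V \in porbits t -> x \in V -> V = porbit t x.
  by case/imsetP => y _ -> xy; apply/esym/eqP; rewrite eq_porbit_mem.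
have tkk : t k \in porbit t k by exact: (mem_porbit t 1).
have notin1 : porbit t k :\ t k \notin porbits t :\ porbit t k.
  rewrite !inE; apply/negP => /andP[/negP ne /mem_orbit Vk]; apply: ne.
  by apply/eqP; apply: Vk; rewrite !inE kt porbit_id.
have notin2 : [set t k] \notin porbit t k :\ t k |: (porbits t :\ porbit t k).
  rewrite !inE !negb_or; apply/andP; split.
    by apply/negP => /eqP/setP/(_ (t k)); rewrite !inE eqxx.
  apply/negP => /andP[/negP ne /mem_orbit Vk]; apply: ne.
  rewrite (Vk (t k)) ?inE ?eqxx //.
  by apply/eqP; apply/eqP; rewrite eq_porbit_mem.
by rewrite big_setU1 // big_setU1.
Qed.

(** Induction on #T - #(g). For g = 1 also t = 1, and each point contributes a full trace #B lam (l
    k). Otherwise a point is peeled off: the factor #A #B of the removal is matched by lam 0 = #A at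
    the peeled point, now fixed by both permutations, and by the additional cycle of g. *)
Lemma geodesic_contraction g t (l : T -> nat) : geodesic g t ->
  tensor_contraction g t l =
    #|B|%:R ^+ #|porbits g| * \prod_(V in porbits t) lam (\sum_(k in V) l k).
Proof.
have [n] := ubnP (#|T| - #|porbits g|); elim: n => // n IH in g t l *.
move=> Hn geo; have [g1|g1] := eqVneq g 1%g.
  move: geo; rewrite g1 => /geodesic1 ->; rewrite card_porbits1.
  have -> : \prod_(V in porbits (1 : {perm T})) lam (\sum_(k in V) l k) =
            \prod_k lam (l k).
    rewrite /porbits big_imset /=; last first.
      move=> x y _ _ exy; have := porbit_id 1%g y.
      by rewrite -exy porbit_fixed ?perm1 // => /eqP.
    apply: eq_big => // k _; congr lam.
    rewrite (eq_bigl (pred1 k)) ?big_pred1_eq // => x /=.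
    by rewrite porbit_fixed ?perm1.
  rewrite /tensor_contraction -prodr_const -big_split /=.
  transitivity (\prod_k \sum_x \sum_y L (l k) (x, y) (x, y)).
    rewrite bigA_distr_bigA /=; apply: eq_bigr => a _.
    rewrite bigA_distr_bigA /=; apply: eq_bigr => b _.
    by apply: eq_bigr => k _; rewrite !perm1.
  apply: eq_bigr => k _; rewrite exchange_big /=.
  by rewrite (eq_bigr (fun=> lam (l k))) ?sumr_const ?mulr_natl // => y _; rewrite L_trace eqxx.
have AB0 : #|A|%:R * #|B|%:R != 0 :> K by rewrite mulf_neq0.
have card_skip k : k != g k -> #|porbits (tperm k (g k) * g)%g| = #|porbits g|.+1.
  by move=> kg; rewrite card_porbits_split // (mem_porbit g 1).
have bound k : k != g k -> (#|T| - #|porbits (tperm k (g k) * g)%g| < n)%N.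
  move=> kg; have := card_porbits_le (tperm k (g k) * g)%g.
  by rewrite card_skip //; exact: ltn_subS.
case: (geodesic_peel geo g1) => k gk [] tk; apply: (mulfI AB0).
  rewrite (contraction_skip_fixed l gk tk) /=; set y := (g^-1)%g k.
  have gy : g y = k by rewrite permKV.
  have yg : y != g y by rewrite gy; apply: contra gk => /eqP yk; rewrite -[X in g X]yk gy.
  rewrite IH ?bound //; last by apply: geodesic_skip_fixed => //; rewrite gy.
  rewrite card_skip // exprS.
  have kt : [set k] \in porbits t.
    by apply/imsetP; exists k => //; apply/setP => x; rewrite porbit_fixed // inE.
  rewrite (big_setD1 [set k]) // [in RHS](big_setD1 [set k]) //= !big_set1 eqxx lam0.
  rewrite (eq_bigr (fun V : {set T} => lam (\sum_(i in V) l i))) => [|V]; last first.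
    rewrite !inE => /andP[Vk /imsetP[x _ VE]]; congr lam; apply: eq_bigr => j jV.
    case: eqP => // jk; case/eqP: Vk; rewrite VE; move: jV; rewrite VE jk => kx.
    apply/setP => z; rewrite inE -(porbit_fixed z tk).
    by move: kx; rewrite porbit_sym -eq_porbit_mem => /eqP->.
  by rewrite [LHS](AC (1*(2*2)) ((4*2)*(3*(1*5)))).
have kg : k != g k by rewrite eq_sym.
have kt : k != t k by rewrite tk.
rewrite (contraction_skip_both l kg tk) /= IH ?bound //; last exact: geodesic_skip_both.
rewrite card_skip // exprS.
have -> : (tperm k (g k) * t = tperm k (t k) * t)%g by rewrite tk.
rewrite big_porbits_skip //.
rewrite [in RHS](big_setD1 (porbit t k)) ?imset_f //= big_set1 tk eqxx lam0.
have -> : \prod_(V in porbits t :\ porbit t k) lam (\sum_(j in V)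
      (if j == g k then 0 else if j == k then l k + l (g k) else l j))%N =
    \prod_(V in porbits t :\ porbit t k) lam (\sum_(j in V) l j).
  apply: eq_bigr => V; rewrite !inE => /andP[Vk /imsetP[x _ VE]].
  congr lam; apply: eq_bigr => j jV.
  have kV : j \notin porbit t k.
    apply: contra Vk; rewrite VE -eq_porbit_mem => /eqP <-.
    by rewrite eq_sym eq_porbit_mem -VE.
  case: eqP => [jt|_]; first by move: kV; rewrite jt -tk (mem_porbit t 1).
  by case: eqP => [jt|_] //; move: kV; rewrite jt porbit_id.
have mem_gk : g k \in porbit t k by rewrite -tk (mem_porbit t 1).
have kP : k \in porbit t k :\ g k by rewrite !inE kg porbit_id.
(* The exponent of g k has moved to k, so the total over the shortened cycle equals the old total
   over the whole cycle. *)
rewrite [in RHS](big_setD1 (g k) mem_gk) /=.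
rewrite (big_setD1 k kP) /= [in RHS](big_setD1 k kP) /= eqxx (negbTE kg).
have -> : (\sum_(j in (porbit t k :\ g k) :\ k)
      (if j == g k then 0 else if j == k then l k + l (g k) else l j) =
    \sum_(j in (porbit t k :\ g k) :\ k) l j)%N.
  by apply: eq_bigr => j; rewrite !inE => /and3P[/negbTE-> /negbTE->].
by rewrite addnA [(l (g k) + l k)%N]addnC; by rewrite [LHS](AC (2*(1*2)) ((3*1)*(2*(4*5)))).
Qed.

End TensorContraction.

Local Open Scope complex_scope.
Local Open Scope ring_scope.

Lemma split_lshift m n (i : 'I_m) : fintype.split (lshift n i) = inl i.
Proof. by rewrite -[lshift n i]/(unsplit (inl i)) unsplitK. Qed.

Lemma split_rshift m n (i : 'I_n) : fintype.split (rshift m i) = inr i.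
Proof. by rewrite -[rshift m i]/(unsplit (inr i)) unsplitK. Qed.

(** * Powers of a matrix on a tensor product, and multi-indices *)

Section TensorPowers.
Variables (K : comNzRingType) (m n : nat).
Implicit Types (M : 'M[K]_(m * n)) (x y z : 'I_m * 'I_n).

Lemma sum_mxtens (V : nmodType) (F : 'I_(m * n) -> V) :
  \sum_k F k = \sum_x F (mxtens_index x).
Proof.
rewrite (reindex (@mxtens_index m n)) //.
by apply: onW_bij; exists (@mxtens_unindex m n); [exact: mxtens_indexK|exact: mxtens_unindexK].
Qed.

Definition tensor_power M l x z : K := (M ^+ l) (mxtens_index x) (mxtens_index z).

Lemma tensor_power0 M x z : tensor_power M 0 x z = (x == z)%:R.
Proof.
by rewrite /tensor_power expr0 !mxE (can_eq (@mxtens_indexK m n)).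
Qed.

Lemma tensor_powerD M i j x z : tensor_power M (i + j) x z =
  \sum_y tensor_power M i x y * tensor_power M j y z.
Proof.
by rewrite /tensor_power exprD -[M ^+ i * M ^+ j]/(M ^+ i *m M ^+ j) mxE sum_mxtens.
Qed.

Lemma trace_tensor_power M l : \tr (M ^+ l) = \sum_x tensor_power M l x x.
Proof. exact: sum_mxtens. Qed.

End TensorPowers.

Section MultiIndex.
Variables s N : nat.
Implicit Types a c : 'I_(N ^ s).

Definition index_of (g : 'I_s -> 'I_N) : 'I_(N ^ s) :=
  cast_ord (card_multi_index s N) (enum_rank (finfun g)).

Lemma multi_index_of g : multi_index (index_of g) =1 g.
Proof. by move=> i; rewrite /multi_index /index_of cast_ordK enum_rankK ffunE. Qed.

Lemma multi_index_inj : injective (@multi_index s N).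
Proof. by move=> a c /enum_val_inj /cast_ord_inj. Qed.

Lemma row_index_lshift a c i : row_index a c (lshift s i) = multi_index a i.
Proof. by rewrite /row_index split_lshift. Qed.

Lemma row_index_rshift a c i : row_index a c (rshift s i) = multi_index c i.
Proof. by rewrite /row_index split_rshift. Qed.

Lemma row_index_swap a c i : row_index a c (half_swap i) = row_index c a i.
Proof.
by rewrite /row_index /half_swap; case: (fintype.split i) => j;
  rewrite ?split_lshift ?split_rshift.
Qed.

End MultiIndex.

(** * Entries of phi_p and Lambda_p *)

Section PhiEntries.
Variables (R : realType) (s N : nat).
Let n := (N ^ s)%N.
Variable p : {set {set row_point (s + s)%N (s + s)%N}}.
Implicit Types a b c d : 'I_n.

Definition delta4 a c b d : bool := delta p (row_index a c) (row_index b d).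

Lemma phiE (x : 'M[R[i]]_n) b d :
  phi p x b d = \sum_a \sum_c x a c * (delta4 a c b d)%:R.
Proof.
rewrite /phi summxE; apply: eq_bigr => a _; rewrite summxE; apply: eq_bigr => c _.
rewrite !mxE summxE; congr (_ * _).
rewrite (bigD1 b) //= summxE (bigD1 d) //= !mxE !eqxx mulr1.
rewrite big1 ?addr0 => [|d' /negbTE dd]; last by rewrite !mxE eq_sym dd andbF mulr0.
rewrite big1 ?addr0 // => b' /negbTE bb; rewrite summxE big1 // => d' _.
by rewrite !mxE eq_sym bb mulr0.
Qed.

Lemma phi_delta_mx a c b d :
  phi p (delta_mx a c : 'M[R[i]]_n) b d = (delta4 a c b d)%:R.
Proof.
rewrite phiE (bigD1 a) //= (bigD1 c) //= !mxE !eqxx mul1r.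
rewrite big1 ?addr0 => [|c' /negbTE cc]; last by rewrite !mxE cc andbF mul0r.
rewrite big1 ?addr0 // => a' /negbTE aa; rewrite big1 // => c' _.
by rewrite !mxE aa mul0r.
Qed.

(** The first leg of [Lambda] carries the two halves a, c of the upper row and the second leg the
    halves b, d of the lower row, whence the order of the arguments of [delta4]. *)
Lemma LambdaE a b c d :
  Lambda (@phi R s N p) (mxtens_index (a, b)) (mxtens_index (c, d)) =
  (delta4 a c b d)%:R.
Proof.
rewrite /Lambda; transitivity (\sum_a' \sum_b' \sum_c' \sum_d'
    (if (a' == a) && (b' == b) && (c' == c) && (d' == d)
     then (delta4 a c b d)%:R else 0 : R[i])).
  rewrite summxE; apply: eq_bigr => a' _; rewrite summxE; apply: eq_bigr => b' _.
  rewrite summxE; apply: eq_bigr => c' _; rewrite summxE; apply: eq_bigr => d' _.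
  rewrite mxE tensmxE !mxE (eq_sym a) (eq_sym b) (eq_sym c) (eq_sym d).
  case: (eqVneq a' a) => [->|_] /=; last by rewrite mul0r mulr0.
  case: (eqVneq c' c) => [->|_] /=; last by rewrite mul0r mulr0 andbF.
  case: (eqVneq b' b) => [->|_] /=; last by rewrite !mulr0.
  case: (eqVneq d' d) => [->|_] /=; last by rewrite !mulr0.
  by rewrite !mulr1 phi_delta_mx.
rewrite (bigD1 a) //= [X in _ + X]big1 ?addr0; last first.
  by move=> a' /negbTE->; do 3 (apply: big1 => ? _).
rewrite (bigD1 b) //= [X in _ + X]big1 ?addr0; last first.
  by move=> b' /negbTE->; rewrite andbF; do 2 (apply: big1 => ? _).
rewrite (bigD1 c) //= [X in _ + X]big1 ?addr0; last first.
  by move=> c' /negbTE->; rewrite andbF; apply: big1.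
rewrite (bigD1 d) //= [X in _ + X]big1 ?addr0; last first.
  by move=> d' /negbTE->; rewrite andbF.
by rewrite !eqxx.
Qed.

Definition valuation a c b d (x : row_point (s + s) (s + s)) : 'I_N :=
  match x with inl i => row_index a c i | inr j => row_index b d j end.

Lemma delta4P a c b d : reflect
  (forall B, B \in p -> forall x y, x \in B -> y \in B ->
    valuation a c b d x = valuation a c b d y) (delta4 a c b d).
Proof.
apply: (iffP forall_inP) => [H B Bp x y xB yB|H B Bp].
  by have /forall_inP/(_ x xB)/forall_inP/(_ y yB)/eqP := H B Bp.
by apply/forall_inP => x xB; apply/forall_inP => y yB; apply/eqP; exact: (H B).
Qed.

Lemma delta4_swap : p = pcirc p -> forall a c b d, delta4 a c b d = delta4 c a d b.
Proof.
move=> sym.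
have imp a c b d : delta4 a c b d -> delta4 c a d b.
  move=> /delta4P H; apply/delta4P => B Bp.
  pose h (x : row_point (s + s) (s + s)) : row_point (s + s) (s + s) :=
    match x with inl i => inl (half_swap i) | inr i => inr (half_swap i) end.
  have vh x : valuation c a d b x = valuation a c b d (h x).
    by case: x => i /=; rewrite row_index_swap.
  move=> x y xB yB; rewrite !vh; apply: (H (h @: B)%SET); last 2 first.
  - exact: imset_f.
  - exact: imset_f.
  by rewrite sym; apply/imsetP; exists B => //; apply: eq_imset => -[].
by move=> a c b d; apply/idP/idP; exact: imp.
Qed.

End PhiEntries.

(** * Components of p with the upper row closed up, and partial traces of powers of Lambda_p *)

Section Components.
Variables (R : realType) (s N : nat).
Let n := (N ^ s)%N.
Variable p : {set {set row_point (s + s)%N (s + s)%N}}.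
Hypothesis p_even : p \in Peven (s + s)%N (s + s)%N.
Hypothesis p_unital : unital_mod_scalars (@phi R s N p).
Hypothesis N_gt1 : (1 < N)%N.
Implicit Types a b c d : 'I_n.
Local Notation pt := (row_point (s + s) (s + s)).

(* When the two upper multi-indices agree, the value at a point is constant along
   links. *)
Definition link (x y : pt) : bool :=
  [exists B in p, (x \in (B : {set pt})) && (y \in B)] ||
  match x, y with inl i, inl j => j == half_swap i | _, _ => false end.

Lemma half_swapK : involutive (@half_swap s).
Proof.
move=> i; rewrite -{2}(splitK i) /half_swap; case: (fintype.split i) => j;
  by rewrite ?split_lshift ?split_rshift.
Qed.

Lemma link_sym : symmetric link.
Proof.
move=> x y; rewrite /link; congr orb.
  by apply: eq_existsb => B; rewrite [(x \in _) && _]andbC.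
by case: x y => i [] j //; apply/eqP/eqP => ->; rewrite half_swapK.
Qed.

Lemma connect_link_sym : connect_sym link.
Proof. exact/sym_connect_sym/link_sym. Qed.

Definition component (i : 'I_s) : {set pt} := [set x | connect link (inr (lshift s i)) x].

Lemma component_block i B x y : B \in p -> x \in B -> y \in B ->
  (x \in component i) = (y \in component i).
Proof.
move=> Bp xB yB; rewrite !inE !(connect_link_sym (inr _)).
apply: same_connect; first exact: connect_link_sym.
by apply: connect1; apply/orP; left; apply/existsP; exists B; rewrite Bp xB yB.
Qed.

Lemma component_swap i j : (inl (half_swap j) \in component i) = (inl j \in component i).
Proof.
rewrite !inE !(connect_link_sym (inr _)); apply/esym/same_connect.
  exact: connect_link_sym.
by apply: connect1; apply/orP; right => /=.
Qed.

Lemma delta4_connect a b d x y : delta4 p a a b d -> connect link x y ->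
  valuation a a b d x = valuation a a b d y.
Proof.
move=> /delta4P H /connectP[q]; elim: q x => [|z q IH] x /=; first by move=> _ ->.
case/andP => /orP[/exists_inP[B Bp /andP[xB zB]]|xz] pq yE.
  by rewrite (H B Bp x z xB zB); exact: IH.
rewrite -(IH z pq yE) {pq yE IH}; case: x z xz => i [] j //= /eqP ->.
by rewrite row_index_swap.
Qed.

Lemma phi1E b d : (@phi R s N p 1%:M) b d = (\sum_a delta4 p a a b d)%:R.
Proof.
rewrite phiE natr_sum; apply: eq_bigr => a _.
rewrite (bigD1 a) //= mxE eqxx mul1r big1 ?addr0 // => c /negbTE ca.
by rewrite mxE eq_sym ca mul0r.
Qed.

(** The entries of phi_p(1) count the admissible a. A sum of natural numbers vanishes only termwise,
    so off the diagonal no a is admissible. *)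
Lemma unital_diag a b d : delta4 p a a b d -> b = d.
Proof.
move=> D; have [k phi1] := p_unital; apply/eqP; apply: contraT => bd.
have := phi1E b d; rewrite phi1 mxE (negbTE bd) mulr0n => /eqP.
by rewrite eq_sym pnatr_eq0 sum_nat_eq0 => /forallP/(_ a); rewrite D.
Qed.

(** All diagonal entries of phi_p(1) equal one scalar, which is nonzero because constant
    multi-indices satisfy every block. *)
Lemma unital_exists b : exists a, delta4 p a a b b.
Proof.
have [k phi1] := p_unital.
have E (e : 'I_n) : (\sum_a delta4 p a a e e)%:R = k.
  by have := phi1E e e; rewrite phi1 mxE eqxx.
pose i0 : 'I_N := Ordinal (ltnW N_gt1).
pose e0 : 'I_n := index_of (fun=> i0).
have e0D : delta4 p e0 e0 e0 e0.
  apply/delta4P => B _ x y _ _.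
  have v0 z : valuation e0 e0 e0 e0 z = i0.
    by case: z => j /=; rewrite /row_index; case: (fintype.split j) => j';
      rewrite multi_index_of.
  by rewrite !v0.
have k0 : k != 0.
  rewrite -(E e0) pnatr_eq0 (bigD1 e0) //= e0D.
  by [].
have : (\sum_a delta4 p a a b b)%N != 0%N by rewrite -(pnatr_eq0 R[i]) E.
rewrite sum_nat_eq0 negb_forall => /existsP[a]; rewrite /= => aD.
by exists a; move: aD; case: (delta4 p a a b b).
Qed.

Let v0 : 'I_N := Ordinal (ltnW N_gt1).
Let v1 : 'I_N := Ordinal N_gt1.

(* If i + s were not linked to i, colouring the component of i by v1 and its
   complement by v0 would give an off-diagonal entry of phi_p(1). *)
Lemma component_rshift i : inr (rshift s i) \in component i.
Proof.
pose v (x : pt) : 'I_N := if x \in component i then v1 else v0.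
pose a : 'I_n := index_of (fun j => v (inl (lshift s j))).
pose b : 'I_n := index_of (fun j => v (inr (lshift s j))).
pose d : 'I_n := index_of (fun j => v (inr (rshift s j))).
have vE x : valuation a a b d x = v x.
  case: x => j /=; rewrite /row_index -{2}(splitK j).
    case: (fintype.split j) => j'; rewrite multi_index_of //= /v.
    by have := component_swap i (lshift s j'); rewrite /half_swap split_lshift => ->.
  by case: (fintype.split j) => j'; rewrite multi_index_of.
have D : delta4 p a a b d.
  apply/delta4P => B Bp x y xB yB; rewrite !vE /v.
  by rewrite (component_block i Bp xB yB).
have := congr1 (fun e => multi_index e i) (unital_diag D).
rewrite !multi_index_of /v inE connect0 /=.
by case: ifP.
Qed.

(* A further lower leg in the component of i would annihilate a diagonal entry of
   phi_p(1), whose (0, 0) entry is nonzero. *)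
Lemma component_lower i j : inr j \in component i ->
  j = lshift s i \/ j = rshift s i.
Proof.
rewrite inE => ij.
have [j' jE] : exists j', j = lshift s j' \/ j = rshift s j'.
  by rewrite -(splitK j); case: (fintype.split j) => j'; exists j'; [left|right].
suff ji : j' = i by rewrite -ji.
apply/eqP; apply: contraT => ji.
pose b : 'I_n := index_of (fun k => if k == i then v1 else v0).
have [a aD] := unital_exists b.
have := delta4_connect aD ij; rewrite /= row_index_lshift.
have -> : row_index b b j = multi_index b j'.
  by case: jE => ->; rewrite ?row_index_lshift ?row_index_rshift.
by rewrite !multi_index_of eqxx (negbTE ji).
Qed.

Lemma component_leg i j : (inr (lshift s j) \in component i) = (j == i) /\
  (inr (rshift s j) \in component i) = (j == i).
Proof.
split; apply/idP/eqP.
- by move/component_lower => [/lshift_inj//|/eqP]; rewrite eq_lrshift.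
- by move->; rewrite inE connect0.
- by move/component_lower => [/eqP|/rshift_inj//]; rewrite eq_rlshift.
- by move->; exact: component_rshift.
Qed.

Definition upper_count i (w : 'I_N) a : nat :=
  #|[pred j | (inl (lshift s j) \in component i) && (multi_index a j == w)]|.

(* The sum counts the points of the component of i with value w, a union of
   blocks. *)
Lemma delta4_parity i w a c b d : delta4 p a c b d ->
  odd (upper_count i w a + upper_count i w c +
       (multi_index b i == w) + (multi_index d i == w)) = false.
Proof.
move=> /delta4P H; pose S : {set pt} := [set x in component i | valuation a c b d x == w].
have -> : (upper_count i w a + upper_count i w c +
       (multi_index b i == w) + (multi_index d i == w) = #|S|)%N.
  rewrite -[#|S|]sum1_card big_mkcond big_sumType /= !big_split_ord /=.
  rewrite /upper_count -!addnA; congr (_ + _)%N.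
    rewrite -sum1_card big_mkcond.
    by apply: eq_bigr => j _; rewrite !inE /= row_index_lshift.
  congr (_ + _)%N.
    rewrite -sum1_card big_mkcond; apply: eq_bigr => j _; rewrite !inE /= row_index_rshift.
    have := component_swap i (lshift s j).
    by rewrite /half_swap split_lshift !inE => ->.
  congr (_ + _)%N.
    rewrite (bigD1 i) //= big1 ?addn0 => [|j /negbTE ji].
      by rewrite !inE connect0 /= row_index_lshift; case: eqP.
    by have [] := component_leg i j; rewrite !inE => -> _; rewrite ji.
  rewrite (bigD1 i) //= big1 ?addn0 => [|j /negbTE ji].
    by have [_] := component_leg i i; rewrite !inE => ->; rewrite eqxx /= row_index_rshift; case: eqP.
  by have [_] := component_leg i j; rewrite !inE => ->; rewrite ji.
have : p \in Peven (s + s) (s + s) := p_even.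
rewrite inE => /andP[part /forall_inP even].
have SE : #|S| = (\sum_(B in p) #|B :&: S|)%N.
  transitivity (\sum_(x in [set: pt]%SET | x \in S) 1)%N.
    by rewrite -sum1_card; apply: eq_bigl => x; rewrite finset.in_setT.
  rewrite (set_partition_big_cond p part); apply: eq_bigr => B _.
  by rewrite -sum1_card; apply: eq_bigl => x; rewrite !inE.
rewrite SE; elim/big_ind: _ => // [x y ox oy|B Bp]; first by rewrite oddD ox oy.
have [->|[x]] := finset.set_0Vmem (B :&: S); first by rewrite cards0.
rewrite !inE => /andP[xB /andP[xi /eqP xw]].
have -> : B :&: S = B.
  apply/finset.setIidPl/fintype.subsetP => y yB; rewrite !inE.
  have := component_block i Bp xB yB; rewrite !inE xi => <- /=.
  by rewrite -xw; apply/eqP; exact: (H B).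
by apply/negbTE; exact: even.
Qed.

Let L := @tensor_power R[i] n n (Lambda (@phi R s N p)).

Let L1E x z : L 1 x z = (delta4 p x.1 z.1 x.2 z.2)%:R.
Proof. by case: x z => [a b] [c d]; rewrite /L /tensor_power expr1 LambdaE. Qed.

(** The parity relation passes to matrix products: a nonzero entry has a nonzero term, and the
    counts at its intermediate index enter twice. *)
Let L_parity i w l x z : L l x z != 0 ->
  odd (upper_count i w x.1 + upper_count i w z.1 +
       (multi_index x.2 i == w) + (multi_index z.2 i == w)) = false.
Proof.
elim: l z => [|l IH] z.
  rewrite /L tensor_power0; have [-> _|_] := eqVneq x z; last by rewrite eqxx.
  by rewrite addnn -addnA addnn -doubleD odd_double.
rewrite -addn1 /L tensor_powerD => nz.
have [y] : exists y, L l x y * L 1 y z != 0.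
  apply/existsP; apply: contraT; rewrite negb_exists => /forallP H.
  by move: nz; rewrite big1 ?eqxx // => y _; apply/eqP; rewrite -[_ == _]negbK.
rewrite mulf_eq0 negb_or => /andP[/IH]; rewrite L1E pnatr_eq0 eqb0 negbK.
move=> + /(delta4_parity i w); rewrite !oddD.
by do 6 case: (odd _).
Qed.

(** With equal first legs the upper counts cancel modulo 2, and the choice w = b_i then forces d_i =
    b_i. *)
Lemma partial_trace_offdiag l b d : b != d ->
  \sum_a L l (a, b) (a, d) = 0.
Proof.
move=> bd; apply: big1 => a _; apply/eqP; apply: contraNT bd => nz.
apply/eqP/multi_index_inj/ffunP => i.
have := L_parity i (multi_index b i) nz.
rewrite /= addnn -addnA oddD odd_double eqxx /=.
by case: eqP => // ->.
Qed.

(* Apply to the colours on the component of i the transposition of b_i and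
   b'_i. *)
Lemma partial_trace_const l b b' :
  \sum_a L l (a, b) (a, b) = \sum_a L l (a, b') (a, b').
Proof.
pose t i : {perm 'I_N} := tperm (multi_index b i) (multi_index b' i).
(* Points outside all components keep their colours. *)
pose Tx (x : pt) : {perm 'I_N} :=
  if [pick i | x \in component i] is Some i then t i else 1%g.
pose A (e : 'I_n) : 'I_n := index_of (fun j => Tx (inl (lshift s j)) (multi_index e j)).
pose B (e : 'I_n) : 'I_n := index_of (fun j => t j (multi_index e j)).
have Tlow j : Tx (inr (lshift s j)) = t j /\ Tx (inr (rshift s j)) = t j.
  rewrite /Tx; split; case: pickP => [i|/(_ j)].
  - by rewrite (component_leg i j).1 => /eqP ->.
  - by rewrite (component_leg j j).1 eqxx.
  - by rewrite (component_leg i j).2 => /eqP ->.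
  - by rewrite (component_leg j j).2 eqxx.
have Tup j : Tx (inl (rshift s j)) = Tx (inl (lshift s j)).
  rewrite /Tx; congr (match _ with Some i => t i | None => _ end).
  apply: eq_pick => i /=; have := component_swap i (lshift s j).
  by rewrite /half_swap split_lshift.
have Tblock V x y : V \in p -> x \in V -> y \in V -> Tx x = Tx y.
  move=> Vp xV yV; rewrite /Tx; congr (match _ with Some i => t i | None => _ end).
  by apply: eq_pick => i /=; exact: component_block Vp xV yV.
have vE a c e f x : valuation (A a) (A c) (B e) (B f) x = Tx x (valuation a c e f x).
  case: x => j /=; rewrite /row_index -{2}(splitK j);
    case: (fintype.split j) => j'; rewrite multi_index_of //=.
  - by rewrite Tup.
  - by rewrite (Tlow j').1.
  - by rewrite (Tlow j').2.
have DE a c e f : delta4 p (A a) (A c) (B e) (B f) = delta4 p a c e f.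
  apply/delta4P/delta4P => H V Vp x y xV yV; have := H V Vp x y xV yV.
    by rewrite !vE (Tblock _ _ _ Vp xV yV) => /perm_inj.
  by rewrite !vE (Tblock _ _ _ Vp xV yV) => ->.
have injA : injective A.
  move=> e f ef; apply/multi_index_inj/ffunP => j.
  have := congr1 (fun g => multi_index g j) ef; rewrite !multi_index_of.
  exact: perm_inj.
have injB : injective B.
  move=> e f ef; apply/multi_index_inj/ffunP => j.
  have := congr1 (fun g => multi_index g j) ef; rewrite !multi_index_of.
  exact: perm_inj.
(* Relabelling both legs at once leaves every power of [Lambda] invariant; [B] sends b to b', and
   [A] merely permutes the terms of the partial trace. *)
have LE k a e c f : L k (A a, B e) (A c, B f) = L k (a, e) (c, f).
  elim: k c f => [|k IH] c f.
    by rewrite /L !tensor_power0 !xpair_eqE (inj_eq injA) (inj_eq injB).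
  rewrite -addn1 /L !tensor_powerD -/L.
  pose h (y : 'I_n * 'I_n) := (A y.1, B y.2).
  have injh : injective h.
    move=> [e1 f1] [e2 f2] E; congr pair.
      exact: injA (congr1 fst E).
    exact: injB (congr1 snd E).
  rewrite (reindex_inj injh) /=; apply: eq_bigr => -[c' f'] _.
  by rewrite /h /= IH !L1E /= DE.
have <- : B b = b'.
  by apply/multi_index_inj/ffunP => j; rewrite multi_index_of /t tpermL.
rewrite [RHS](reindex_inj injA) /=; apply: eq_bigr => a _.
by rewrite LE.
Qed.

End Components.

(** The partial trace is diagonal with constant diagonal, so each of the n diagonal entries is the
    n-th part of the full trace. The case N = 1 is separate, as the colouring arguments need two
    colours. *)
Lemma Lambda_partial_trace (R : realType) (s N : nat)
    (p : {set {set row_point (s + s)%N (s + s)%N}}) :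
  (0 < N)%N -> p \in Peven (s + s)%N (s + s)%N ->
  unital_mod_scalars (@phi R s N p) ->
  forall l (b d : 'I_(N ^ s)),
  \sum_a tensor_power (Lambda (@phi R s N p)) l (a, b) (a, d) =
  (\tr (Lambda (@phi R s N p) ^+ l) / (N ^ s)%:R) *+ (b == d).
Proof.
move=> N0 p_even p_unital l b d.
have n0 : (N ^ s)%:R != 0 :> R[i] by rewrite pnatr_eq0 expn_eq0 negb_and -lt0n N0.
have [off const] : (forall b d : 'I_(N ^ s), b != d ->
      \sum_a tensor_power (Lambda (@phi R s N p)) l (a, b) (a, d) = 0) /\
    (forall b b' : 'I_(N ^ s),
      \sum_a tensor_power (Lambda (@phi R s N p)) l (a, b) (a, b) =
      \sum_a tensor_power (Lambda (@phi R s N p)) l (a, b') (a, b')).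
  have [N1|N1] := ltnP 1 N.
    split; [exact: partial_trace_offdiag|exact: partial_trace_const].
  have eqi (b1 b2 : 'I_(N ^ s)) : b1 = b2.
    apply/multi_index_inj/ffunP => i; apply/val_inj => /=.
    by case: (multi_index b1 i) (multi_index b2 i) => [x hx] [y hy] /=; lia.
  by split=> b1 b2; rewrite (eqi b1 b2) ?eqxx.
have [<-|bd] := eqVneq b d; last by rewrite off.
rewrite mulr1n.
have -> : \tr (Lambda (@phi R s N p) ^+ l) =
    \sum_a \sum_b tensor_power (Lambda (@phi R s N p)) l (a, b) (a, b).
  by rewrite trace_tensor_power pair_bigA; apply: eq_bigr => -[].
rewrite exchange_big /= (eq_bigr _ (fun b' _ => const b' b)) sumr_const card_ord.
by rewrite -[X in X / _]mulr_natr mulfK.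
Qed.

(** * Sums over noncrossing partitions as sums over geodesics *)

Lemma noncrossingP p (sigma : {set {set 'I_p}}) : noncrossing sigma ->
  exists2 t, geodesic (ord_cycle p) t & porbits t = sigma.
Proof.
case/andP => part /forall_inP nc; have [/eqP cov triv no0] := and3P part.
have inb x : x \in finset.cover sigma by rewrite cov finset.in_setT.
pose e : rel 'I_p := fun x y => y \in finset.pblock sigma x.
have eE x y : e x y = (finset.pblock sigma x == finset.pblock sigma y).
  by rewrite /e finset.eq_pblock.
have equiv : equivalence_rel e.
  by move=> x y z; rewrite !eE eqxx; split=> // /eqP ->.
have ncr : noncrossing_rel e.
  move=> i j k l ij jk kl; rewrite !eE => /eqP ik /eqP jl; apply: contraT => nij.
  have Bi := finset.pblock_mem (inb i); have Bj := finset.pblock_mem (inb j).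
  have /forall_inP/(_ _ Bj)/implyP/(_ nij) := nc _ Bi.
  have mi x : x \in finset.pblock sigma x by rewrite finset.mem_pblock.
  move=> /forall_inP/(_ i (mi i))/forall_inP/(_ j (mi j)).
  move=> /forall_inP/(_ k)/(_ _)/forall_inP/(_ l).
  by rewrite ik jl !mi ij jk kl => /(_ isT isT).
have [t geo te] := noncrossing_geodesic equiv ncr.
have tP x : porbit t x = finset.pblock sigma x.
  by apply/setP => y; exact: te.
exists t => //; apply/setP => V; apply/imsetP/idP => [[x _ ->]|Vs].
  by rewrite tP finset.pblock_mem.
have [x xV] : exists x, x \in V.
  by apply/finset.set0Pn; apply: contraNneq no0 => <-.
by exists x => //; rewrite tP (finset.def_pblock triv Vs xV).
Qed.

Lemma porbits_noncrossing p (t : {perm 'I_p}) : geodesic (ord_cycle p) t ->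
  noncrossing (porbits t).
Proof.
move=> geo; rewrite /noncrossing porbits_partition /=.
apply/forall_inP => _ /imsetP[x _ ->]; apply/forall_inP => _ /imsetP[y _ ->].
apply/implyP => xy; apply/forall_inP => i xi; apply/forall_inP => j yj.
apply/forall_inP => k xk; apply/forall_inP => l yl.
apply/negP => /and3P[ij jk kl]; case/negP: xy.
move: xi yj xk yl; rewrite -!eq_porbit_mem => /eqP xi /eqP yj /eqP xk /eqP yl.
have := geodesic_noncrossing geo ij jk kl.
rewrite -!eq_porbit_mem xi yj xk yl !eqxx => /(_ isT isT).
by rewrite eq_sym.
Qed.

Lemma porbits_inj_geodesic p :
  {in [pred t | geodesic (ord_cycle p) t] &, injective (@porbits 'I_p)}.
Proof.
move=> t1 t2 /= geo1 geo2 t12; apply: geodesic_inj geo1 geo2 _ => x y.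
have Vx : porbit t1 x = porbit t2 x.
  have /imsetP[z _ xz] : porbit t1 x \in porbits t2 by rewrite -t12 imset_f.
  by rewrite xz; apply/eqP; rewrite eq_porbit_mem porbit_sym -xz porbit_id.
by rewrite /porbit_rel Vx.
Qed.

Lemma sum_noncrossing (V : nmodType) p (F : {set {set 'I_p}} -> V) :
  \sum_(sigma | noncrossing sigma) F sigma =
  \sum_(t | geodesic (ord_cycle p) t) F (porbits t).
Proof.
rewrite -(big_imset (h := @porbits 'I_p) (A := [pred t | geodesic (ord_cycle p) t])) /=.
  apply: eq_bigl => sigma; apply/idP/imsetP => [/noncrossingP[t geo <-]|[t geo ->]].
    by exists t.
  exact: porbits_noncrossing.
by move=> t1 t2; exact: porbits_inj_geodesic.
Qed.

Lemma porbits_ord_cycle p : porbits (ord_cycle p.+1) = [set [set: 'I_p.+1]%SET]%SET.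
Proof.
have orb0 : porbit (ord_cycle p.+1) ord0 = [set: 'I_p.+1]%SET.
  apply/setP => x; rewrite finset.in_setT.
  have := @ord_cycle_walk p.+1 1%g ord0 x; rewrite invg1 mul1g; apply=> //.
  by move=> z _; rewrite perm1.
apply/setP => V; rewrite finset.in_set1; apply/imsetP/eqP => [[x _ ->]|->].
  by rewrite -orb0; apply/eqP; rewrite eq_porbit_mem orb0 finset.in_setT.
by exists ord0.
Qed.

(** * Expansion of traces, and counting of functions constant on cycles *)

Section Sums.
Variable K : numFieldType.

(** A contraction with one-dimensional second leg and t = g the full cycle, which is a single cycle
    of total exponent p + 1. *)
Lemma trace_exp_sum m n (M : 'M[K]_(m * n)) p : (0 < m * n)%N ->
  \tr (M ^+ p.+1) = \sum_(f : {ffun 'I_p.+1 -> 'I_m * 'I_n})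
    \prod_k M (mxtens_index (f k)) (mxtens_index (f (ord_cycle p.+1 k))).
Proof.
move=> mn0; set g := ord_cycle p.+1.
pose L l (x y : ('I_m * 'I_n) * unit) := tensor_power M l x.1 y.1.
have := @geodesic_contraction _ ('I_m * 'I_n)%type unit K L (fun l => \tr (M ^+ l))
  _ _ _ _ _ g g (fun=> 1%N) (geodesicxx g).
rewrite card_unit expr1n mul1r porbits_ord_cycle finset.big_set1 sum1_card finset.cardsT card_ord => <-.
- rewrite /tensor_contraction; apply: eq_bigr => f _.
  rewrite (big_pred1 [ffun=> tt]) /=; last first.
    by move=> b; apply/esym/eqP/ffunP => k; rewrite ffunE; case: (b k).
  by apply: eq_bigr => k _; rewrite /L /tensor_power expr1.
- by move=> [x []] [y []]; rewrite /L tensor_power0 xpair_eqE andbT.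
- move=> i j x z; rewrite /L tensor_powerD.
  rewrite -(pair_bigA _ (fun y u => tensor_power M i x.1 y * tensor_power M j y z.1)) /=.
  by apply: eq_bigr => y _; rewrite sumr_const card_unit.
- by move=> l [] []; rewrite eqxx mulr1n trace_tensor_power.
- by rewrite card_prod !card_ord pnatr_eq0 -lt0n.
- by rewrite oner_eq0.
Qed.

(** The contraction with every [L l] the identity and a one-dimensional second leg; each cycle of s
    contributes the trace #J. *)
Lemma count_fixed_functions (J T : finType) (s : {perm T}) : (0 < #|J|)%N ->
  \sum_(f : {ffun T -> J}) \prod_k (f (s k) == f k)%:R =
  #|J|%:R ^+ #|porbits s| :> K.
Proof.
move=> J0.
pose L (l : nat) (x y : J * unit) := (x == y)%:R : K.
have := @geodesic_contraction T J unit K L (fun l => #|J|%:R)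
  _ _ _ _ _ s s (fun=> 1%N) (geodesicxx s).
rewrite card_unit expr1n mul1r prodr_const => <- //.
- rewrite /tensor_contraction; apply: eq_bigr => f _.
  rewrite (big_pred1 [ffun=> tt]) /=; last first.
    by move=> b; apply/esym/eqP/ffunP => k; rewrite ffunE; case: (b k).
  by apply: eq_bigr => k _; rewrite /L xpair_eqE andbT eq_sym.
- move=> i j x z; rewrite /L (bigD1 x) //= eqxx mul1r big1 ?addr0 // => y.
  by rewrite eq_sym => /negbTE->; rewrite mul0r.
- move=> l [] []; rewrite /L (eq_bigr (fun=> 1)) ?sumr_const // => x _.
  by rewrite eqxx.
- by rewrite pnatr_eq0 -lt0n.
Qed.

Lemma sum_ffun_pair (V : nmodType) (T A B : finType) (F : {ffun T -> A * B} -> V) :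
  \sum_f F f = \sum_(a : {ffun T -> A}) \sum_(b : {ffun T -> B}) F [ffun k => (a k, b k)].
Proof.
rewrite pair_bigA /= (reindex (fun ab : {ffun T -> A} * {ffun T -> B} =>
  [ffun k => (ab.1 k, ab.2 k)])) //.
apply: onW_bij; exists (fun f : {ffun T -> A * B} => ([ffun k => (f k).1], [ffun k => (f k).2])).
  by move=> [a b]; congr pair; apply/ffunP => k; rewrite !ffunE.
by move=> f; apply/ffunP => k; rewrite !ffunE -surjective_pairing.
Qed.

End Sums.

(** * From indicators to nonnegative measurable functions *)

Section IndicatorExtension.
Local Open Scope classical_set_scope.
Local Open Scope ring_scope.
Import HBNNSimple.
Variable R : realType.

Section OneMeasure.
Local Open Scope classical_set_scope.
Local Open Scope ring_scope.
Variables (d : measure_display) (T : measurableType d).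
Variables (mu : {measure set T -> \bar R}) (X : T -> R) (H : T -> R).
Hypothesis mX : measurable_fun setT X.
Hypothesis mH : measurable_fun setT H.
Hypothesis H0 : forall x, 0 <= H x.

Lemma integral_nnsfun_comp (h : {nnsfun R >-> R}) :
  (\int[mu]_x (h (X x) * H x)%:E = \sum_(r \in range h)
     r%:E * \int[mu]_x (\1_(h @^-1` [set r]) (X x) * H x)%:E)%E.
Proof.
have m1 r : measurable_fun setT (fun x => \1_(h @^-1` [set r]) (X x) * H x).
  by apply: measurable_funM => //; apply: measurableT_comp => //.
have ind0 r x : 0 <= \1_(h @^-1` [set r]) (X x) * H x.
  by rewrite mulr_ge0.
transitivity (\int[mu]_x \sum_(r \in range h)
    (r%:E * (\1_(h @^-1` [set r]) (X x) * H x)%:E))%E.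
  apply: eq_integral => x _; rewrite fimfunE EFinM -fsumEFin // ge0_mule_fsuml.
    by apply: eq_fsbigr => r _; rewrite -!EFinM mulrA.
  by move=> r; exact: nnfun_muleindic_ge0.
rewrite ge0_integral_fsum //.
- apply: eq_fsbigr => r; rewrite inE => -[y _ <-].
  by rewrite ge0_integralZl //; [exact/measurable_EFinP|move=> x _; rewrite lee_fin|rewrite lee_fin].
- by move=> r; apply: measurable_funeM; exact/measurable_EFinP.
- move=> r x _; rewrite -EFinM mulrA EFinM mule_ge0 ?lee_fin //.
  exact: nnfun_muleindic_ge0.
Qed.

Lemma cvg_integral_nnsfun_comp (f : R -> R) (f0 : forall x, 0 <= f x)
    (mf : measurable_fun setT (EFin \o f)) :
  (\int[mu]_x (nnsfun_approx measurableT mf n (X x) * H x)%:E)%E @[n --> \oo]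
    --> (\int[mu]_x (f (X x) * H x)%:E)%E.
Proof.
pose g n x := (nnsfun_approx measurableT mf n (X x) * H x)%:E.
have -> : (\int[mu]_x (f (X x) * H x)%:E = \int[mu]_x (limn (g ^~ x)))%E.
  apply: eq_integral => x _; apply/esym/cvg_lim => //.
  rewrite /g; under eq_fun do rewrite EFinM.
  rewrite EFinM; apply: cvgeZr => //.
  exact: (@cvg_nnsfun_approx _ _ _ setT measurableT (EFin \o f) mf
           (fun x _ => f0 x) (X x) I).
apply: cvg_monotone_convergence => //.
- move=> n; apply/measurable_EFinP/measurable_funM => //.
  by apply: measurableT_comp.
- by move=> n x _; rewrite lee_fin mulr_ge0.
- move=> x _ a b ab; rewrite lee_fin ler_wpM2r //.
  exact/lefP/nd_nnsfun_approx.
Qed.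

End OneMeasure.

(** Linearity extends the identity to simple functions, and monotone convergence to f. The two
    measure spaces may differ, which covers both a change of variables and the splitting off of one
    independent factor. *)
Lemma integral_indic_ext d1 d2 (T1 : measurableType d1) (T2 : measurableType d2)
    (mu1 : {measure set T1 -> \bar R}) (mu2 : {measure set T2 -> \bar R})
    (X1 H1 : T1 -> R) (X2 H2 : T2 -> R) :
  measurable_fun setT X1 -> measurable_fun setT H1 -> (forall x, 0 <= H1 x) ->
  measurable_fun setT X2 -> measurable_fun setT H2 -> (forall x, 0 <= H2 x) ->
  (forall B, measurable B -> \int[mu1]_x (\1_B (X1 x) * H1 x)%:E =
                             \int[mu2]_x (\1_B (X2 x) * H2 x)%:E)%E ->
  forall f : R -> R, measurable_fun setT f -> (forall x, 0 <= f x) ->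
  (\int[mu1]_x (f (X1 x) * H1 x)%:E = \int[mu2]_x (f (X2 x) * H2 x)%:E)%E.
Proof.
move=> mX1 mH1 H10 mX2 mH2 H20 indE f mf f0.
have mEf : measurable_fun setT (EFin \o f) by exact/measurable_EFinP.
have c1 := cvg_integral_nnsfun_comp (mu := mu1) mX1 mH1 H10 f0 mEf.
have c2 := cvg_integral_nnsfun_comp (mu := mu2) mX2 mH2 H20 f0 mEf.
rewrite -(cvg_lim _ c1) // -(cvg_lim _ c2) //.
under [in LHS]eq_fun do rewrite integral_nnsfun_comp //.
under [in RHS]eq_fun do rewrite integral_nnsfun_comp //.
do 2 f_equal; apply/funext => n.
by apply: eq_fsbigr => r _; rewrite indE.
Qed.

End IndicatorExtension.

(** * Expectations of products of independent variables *)

Section IndependentProduct.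
Local Open Scope classical_set_scope.
Local Open Scope ring_scope.
Variables (R : realType) (d : measure_display) (T : measurableType d).
Variables (P : probability T R) (I : finType) (X : I -> {RV P >-> R}).
Hypothesis indX : mutually_independent X.

Lemma EFin_Rintegral (f : T -> R) : P.-integrable setT (EFin \o f) ->
  (\int[P]_t f t)%:E = (\int[P]_t (f t)%:E)%E.
Proof. by move=> fi; rewrite /Rintegral fineK // integrable_fin_num. Qed.

Lemma independent_indicators (B : I -> set R) :
  (forall i, measurable (B i)) ->
  (\int[P]_t (\prod_i \1_(B i) (X i t))%:E =
     (\prod_i \int[P]_t \1_(B i) (X i t))%:E)%E.
Proof.
move=> mB.
have mXB i : measurable (X i @^-1` B i).
  by rewrite -[X in measurable X]setTI; exact: measurable_funP.
have -> : (\int[P]_t (\prod_i \1_(B i) (X i t))%:E =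
    \int[P]_t (\1_(\bigcap_(i in [set` [set: I]%SET]) (X i @^-1` B i)) t)%:E)%E.
  apply: eq_integral => t _; congr EFin; rewrite [RHS]indicE.
  have [tin|tnot] := pselect (forall i, B i (X i t)).
    rewrite mem_set ?big1 // => [i _|i _]; first by rewrite indicE mem_set.
    exact: tin.
  have /existsNP[i Bi] := tnot.
  have -> : \prod_j \1_(B j) (X j t) = 0 :> R.
    by rewrite (bigD1 i) //= indicE memNset // mul0r.
  by rewrite memNset // => H; apply: Bi; apply: H; rewrite /= inE.
rewrite integral_indic //; last first.
  by apply: fin_bigcap_measurable => // i _; exact: mXB.
rewrite setIT.
transitivity (\prod_(i in [set: I]%SET) P (X i @^-1` B i))%E.
  exact: indX.
rewrite -prodEFin; apply: eq_big => [i|i _]; first by rewrite inE.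
rewrite EFin_Rintegral.
  by rewrite -[RHS]/(\int[P]_t (\1_(X i @^-1` B i) t)%:E)%E integral_indic // setIT.
exact: (integrable_indic P (mXB i)).
Qed.

Lemma independent_product_ge0 (f : I -> R -> R) :
  (forall i, measurable_fun setT (f i)) -> (forall i x, 0 <= f i x) ->
  (forall i, P.-integrable setT (fun t => (f i (X i t))%:E)) ->
  (\int[P]_t (\prod_i f i (X i t))%:E = (\prod_i \int[P]_t f i (X i t))%:E)%E.
Proof.
move=> mf f0 fi.
(* Induction on the list of indices whose factor is not yet assumed to be an indicator. *)
suff H (s : seq I) : forall f : I -> R -> R,
  (forall i, measurable_fun setT (f i)) -> (forall i x, 0 <= f i x) ->
  (forall i, P.-integrable setT (fun t => (f i (X i t))%:E)) ->
  (forall i, i \notin s -> exists2 B, measurable B & f i = \1_B) ->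
  (\int[P]_t (\prod_i f i (X i t))%:E = (\prod_i \int[P]_t f i (X i t))%:E)%E.
  by apply: (H (enum I)) => // i; rewrite mem_enum.
elim: s => [|i s IH] {}f {}mf {}f0 {}fi find.
  have /choice[B HB] i : exists B, measurable B /\ f i = \1_B.
    by have [//|B] := find i; exists B.
  under eq_integral => t _ do under eq_bigr => i _ do rewrite (HB i).2.
  rewrite independent_indicators; last by move=> i; exact: (HB i).1.
  by congr EFin; apply: eq_bigr => i _; rewrite (HB i).2.
pose H t := \prod_(j | j != i) f j (X j t).
pose c := \prod_(j | j != i) \int[P]_t f j (X j t).
have mX j : measurable_fun setT (X j) by exact: measurable_funP.
have mH : measurable_fun setT H.
  rewrite /H; under eq_fun do rewrite big_mkcond /=.
  apply: measurable_prod => j _.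
  by case: (j != i) => //; apply: measurableT_comp.
have H0 t : 0 <= H t by apply: prodr_ge0.
have c0 : 0 <= c by apply: prodr_ge0 => j _; apply: Rintegral_ge0.
have -> : (\int[P]_t (\prod_j f j (X j t))%:E = \int[P]_t (f i (X i t) * H t)%:E)%E.
  by apply: eq_integral => t _; rewrite (bigD1 i).
rewrite (bigD1 i) //= -/c.
(* Only the factor i varies: the product [H] of the others is compared with the constant [c], the
   product of their expectations. For indicators this is the induction hypothesis. *)
rewrite (@integral_indic_ext _ _ _ _ _ P P (X i) H (X i) (cst c)) //.
  rewrite EFinM EFin_Rintegral; last exact: fi.
  under eq_integral do rewrite /= EFinM.
  rewrite ge0_integralZr //; first exact: (measurable_int P).
  by move=> t _; rewrite lee_fin.
move=> B mB.
pose g j := if j == i then \1_B : R -> R else f j.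
have gi : g i = \1_B by rewrite /g eqxx.
have gj j : j != i -> g j = f j by rewrite /g => /negbTE ->.
have mind : measurable_fun setT (\1_B : R -> R) by exact: measurable_indic.
have iB : P.-integrable setT (fun t => (\1_B (X i t))%:E).
  apply: (integrable_indic P (A := X i @^-1` B)).
  by rewrite -[X in measurable X]setTI; exact: mX.
have := IH g; rewrite (bigD1 i) //= gi -/c.
have -> : \prod_(j | j != i) \int[P]_t g j (X j t) = c.
  by apply: eq_bigr => j ji; rewrite gj.
rewrite EFinM EFin_Rintegral // => IHg.
under [RHS]eq_integral do rewrite /= EFinM.
rewrite ge0_integralZr //; last first.
  exact: (measurable_int _ iB).
rewrite -IHg.
- apply: eq_integral => t _; rewrite (bigD1 i) //= gi; congr (_ * _)%:E.
  by apply: eq_bigr => j ji; rewrite gj.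
- by move=> j; rewrite /g; case: ifP.
- by move=> j x; rewrite /g; case: ifP.
- by move=> j; rewrite /g; case: eqP => [->|_].
- move=> j js; rewrite /g; case: eqP => [_|/eqP ji]; first by exists B.
  by apply: find; rewrite inE negb_or ji.
Qed.

Lemma independent_product (f : I -> R -> R) :
  (forall i, measurable_fun setT (f i)) ->
  (forall i, P.-integrable setT (fun t => (f i (X i t))%:E)) ->
  P.-integrable setT (fun t => (\prod_i f i (X i t))%:E) /\
  \int[P]_t (\prod_i f i (X i t)) = \prod_i \int[P]_t f i (X i t).
Proof.
move=> mf fi.
have mX j : measurable_fun setT (X j) by exact: measurable_funP.
have int_prod (g : I -> R -> R) : (forall i, measurable_fun setT (g i)) ->
    (forall i, P.-integrable setT (fun t => (g i (X i t))%:E)) ->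
    P.-integrable setT (fun t => (\prod_i g i (X i t))%:E).
  move=> mg gi; apply/integrableP; split.
    apply/measurable_EFinP; apply: measurable_prod => j _.
    by apply: measurableT_comp.
  under eq_integral do rewrite /= normr_prod.
  rewrite (@independent_product_ge0 (fun i x => `|g i x|)) ?ltry //.
    by move=> i; apply: measurableT_comp.
  by move=> i; exact: integrable_norm (gi i).
split; first exact: int_prod.
(* The same induction, now on the indices whose factor may change sign; one factor at a time is
   split into positive and negative parts. *)
suff H (s : seq I) : forall f : I -> R -> R,
  (forall i, measurable_fun setT (f i)) ->
  (forall i, P.-integrable setT (fun t => (f i (X i t))%:E)) ->
  (forall i, i \notin s -> forall x, 0 <= f i x) ->
  \int[P]_t (\prod_i f i (X i t)) = \prod_i \int[P]_t f i (X i t).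
  by apply: (H (enum I)) => // i; rewrite mem_enum.
elim: s => [|i s IH] {}f {}mf {}fi f0.
  apply: EFin_inj; rewrite EFin_Rintegral; last exact: int_prod.
  by apply: independent_product_ge0 => // i x; exact: f0.
pose upd g j := if j == i then g else f j.
have updi g : upd g i = g by rewrite /upd eqxx.
have updj g j : j != i -> upd g j = f j by rewrite /upd => /negbTE ->.
pose c := \prod_(j | j != i) \int[P]_t f j (X j t).
have prod_upd g t : \prod_j upd g j (X j t) =
    g (X i t) * \prod_(j | j != i) f j (X j t).
  rewrite (bigD1 i) //= updi; congr (_ * _).
  by apply: eq_bigr => j ji; rewrite updj.
have IHu (g : R -> R) : measurable_fun setT g -> (forall x, 0 <= g x) ->
    P.-integrable setT (fun t => (g (X i t))%:E) ->
    P.-integrable setT (fun t => (\prod_j upd g j (X j t))%:E) /\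
    \int[P]_t (\prod_j upd g j (X j t)) = \int[P]_t g (X i t) * c.
  move=> mg g0 gi; split.
    apply: int_prod => j; rewrite /upd; first by case: ifP.
    by case: eqP => [->|_].
  rewrite IH.
  - rewrite (bigD1 i) //= updi; congr (_ * _).
    by apply: eq_bigr => j ji; rewrite updj.
  - by move=> j; rewrite /upd; case: ifP.
  - by move=> j; rewrite /upd; case: eqP => [->|_].
  - move=> j js; rewrite /upd; case: eqP => // /eqP ji.
    by apply: f0; rewrite inE negb_or ji.
have pos := IHu (f i)^\+ _ _ _.
have neg := IHu (f i)^\- _ _ _.
have [||ip Ep] := pos _ (funrpos_ge0 _).
- exact: measurable_funrpos.
- exact: (integrable_funrpos measurableT (fi i)).
have [||iq Eq] := neg _ (funrneg_ge0 _).
- exact: measurable_funrneg.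
- exact: (integrable_funrneg measurableT (fi i)).
transitivity (\int[P]_t (\prod_j upd (f i)^\+ j (X j t) - \prod_j upd (f i)^\- j (X j t))).
  apply: eq_Rintegral => t _; rewrite !prod_upd -mulrBl (bigD1 i) //=.
  by rewrite -{1}(funrposBneg (f i)).
rewrite RintegralB // Ep Eq -mulrBl -RintegralB //.
- rewrite (bigD1 i) //=; congr (_ * _).
  by apply: eq_Rintegral => t _; rewrite -[in RHS](funrposBneg (f i)).
- exact: (integrable_funrpos measurableT (fi i)).
- exact: (integrable_funrneg measurableT (fi i)).
Qed.

End IndependentProduct.

(** * Moments of the normal density of variance 1/2 *)

Section GaussianMoments.
Local Open Scope classical_set_scope.
Local Open Scope ring_scope.
Variable R : realType.
Let mu := @lebesgue_measure R.
Let sigma : R := Num.sqrt 2^-1.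
Let w : R -> R := normal_pdf 0 sigma.

Let sigma_neq0 : sigma != 0.
Proof. by rewrite gt_eqF // sqrtr_gt0 invr_gt0. Qed.

Lemma normal_pdf_half : w = fun x => normal_peak sigma * expR (- x ^+ 2).
Proof.
apply/funext => x; rewrite /w normal_pdfE // /normal_fun subr0.
by rewrite sqr_sqrtr ?invr_ge0 // -mulr_natr mulVf ?pnatr_eq0 // divr1.
Qed.

Let w_ge0 x : 0 <= w x.
Proof. exact: normal_pdf_ge0. Qed.

Let measurable_w : measurable_fun setT w.
Proof. exact: measurable_normal_pdf. Qed.

Lemma expr_le_sqr_expr (x : R) k : `|x| ^+ k <= 1 + x ^+ 2 ^+ k.+1.
Proof.
rewrite -normrX -(real_normK (num_real x)) -exprM.
have [x1|x1] := leP `|x| 1.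
  by rewrite normrX (le_trans (exprn_ile1 _ _ x1)) // ler_wpDr // exprn_ge0.
rewrite normrX; apply: ler_wpDl => //.
by apply: ler_weXn2l; [exact: ltW|rewrite mulnC muln2 -addnn leqW // leq_addr].
Qed.

(** With y = x^2 / 2, |x|^k <= 1 + (2 y)^(k+1) and y^(k+1) <= (k+1)! e^y. One of the two factors
    e^(-y) of e^(-x^2) pays for this growth, the other remains. *)
Let C k : R := normal_peak sigma * (1 + 2 ^+ k.+1 * k.+1`!%:R).

Lemma normal_moment_bound k x :
  `|x| ^+ k * w x <= C k * expR (- (x ^+ 2 / 2)).
Proof.
rewrite normal_pdf_half /C mulrCA -[leRHS]mulrA ler_wpM2l ?normal_peak_ge0 //.
have -> : - x ^+ 2 = - (x ^+ 2 / 2) - x ^+ 2 / 2 by field.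
set y := x ^+ 2 / 2; have y0 : 0 <= y by rewrite divr_ge0 ?sqr_ge0.
rewrite expRD mulrA ler_wpM2r ?expR_ge0 // expRN ler_pdivrMr ?expR_gt0 //.
apply: le_trans (expr_le_sqr_expr x k) _.
have -> : x ^+ 2 = y * 2 by rewrite /y; field.
have e1 : 1 <= expR y by rewrite -expR0 ler_expR.
have := expR_ge1Dxn k y0; rewrite -lerBrDl ler_pdivrMr ?ltr0n ?fact_gt0 // => H.
rewrite mulrDl mul1r lerD // exprMn [_ * 2 ^+ _]mulrC -mulrA ler_wpM2l ?exprn_ge0 //.
apply: le_trans H _; rewrite mulrC ler_wpM2l ?ler0n //.
by rewrite gerBl.
Qed.

Lemma integrable_expR_sqr : mu.-integrable setT (fun x => (expR (- (x ^+ 2 / 2)))%:E).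
Proof.
have H := integrable_normal_pdf (0 : R) 1.
have p0 := normal_peak_gt0 (oner_neq0 R).
have := integrableZl measurableT (normal_peak 1)^-1 H.
apply: eq_integrable => //.
move=> x _ /=; rewrite normal_pdfE ?oner_neq0 // /normal_fun subr0 expr1n mulNr.
by rewrite -EFinM mulKf // gt_eqF.
Qed.

Lemma integrable_normal_moment k : mu.-integrable setT (fun x => (x ^+ k * w x)%:E).
Proof.
have := integrableZl measurableT (C k) integrable_expR_sqr.
apply: le_integrable => //.
  by apply/measurable_EFinP; apply: measurable_funM => //.
move=> x _ /=; rewrite lee_fin normrM normrX (ger0_norm (w_ge0 x)).
by apply: le_trans (normal_moment_bound k x) (ler_norm _).
Qed.

Lemma is_derive_normal_pdf_half (x : R) : is_derive x 1 w (- (2 * x) * w x).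
Proof.
pose q (y : R) := - y ^+ 2.
have dq : is_derive x 1 q (- (2 * x)).
  have -> : q = - (id ^+ 2) by apply/funext => y; rewrite /q !fctE.
  by apply: is_derive_eq; rewrite /= expr1 -[_ *: _]/(_ * _) mulr1.
have deq : is_derive x 1 (expR \o q) (- (2 * x) * expR (q x)).
  apply: DeriveDef.
    apply/derivable1_diffP/differentiable_comp; apply/derivable1_diffP.
      by case: dq.
    exact: derivable_expR.
  by rewrite -derive1E derive1_comp // !derive1E !derive_val mulrC.
have -> : w = normal_peak sigma \*: (expR \o q).
  by rewrite normal_pdf_half; apply/funext.
by apply: is_derive_eq; rewrite /= -![_ *: _]/(_ * _) mulrCA.
Qed.

(** For k = 0 the coefficient k removes the first term, so the truncated [k.-1] is harmless. *)
Lemma is_derive_normal_moment k (x : R) :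
  is_derive x 1 (fun y : R => y ^+ k * w y)
    (k%:R * (x ^+ k.-1 * w x) - 2 * (x ^+ k.+1 * w x)).
Proof.
have := is_derive_normal_pdf_half x => dw.
have -> : (fun y : R => y ^+ k * w y) = (id ^+ k : R -> R) * w.
  by apply/funext => y; rewrite !fctE.
apply: is_derive_eq.
rewrite exprfctE -![_ *: _]/(_ * _) exprS /=; ring.
Qed.

Let F k (x : R) := x ^+ k * w x.
Let f k (x : R) := k%:R * F k.-1 x - 2 * F k.+1 x.

Let integrable_f k : mu.-integrable setT (EFin \o f k).
Proof.
rewrite (_ : EFin \o f k = (fun x => k%:R%:E * (F k.-1 x)%:E - 2%:E * (F k.+1 x)%:E)%E) //.
apply: integrableB => //; apply: integrableZl => //; exact: integrable_normal_moment.
Qed.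

Let continuous_F k : continuous (F k).
Proof.
move=> x; apply/differentiable_continuous/derivable1_diffP.
by have [] := is_derive_normal_moment k x.
Qed.

Let continuous_f k : continuous (f k).
Proof.
move=> x; apply: cvgB; (apply: cvgM; [exact: cvg_cst|exact: continuous_F]).
Qed.

Let integral_itv_f k (n : nat) :
  (\int[mu]_(x in `[(- n.+1%:R)%R, n.+1%:R%R]) (f k x)%:E =
   (F k n.+1%:R - F k (- n.+1%:R))%:E)%E.
Proof.
rewrite EFinB; apply: continuous_FTC2.
- by rewrite -subr_gt0 opprK -mulr2n pmulrn_lgt0 // ltr0n.
- exact: continuous_subspaceT.
- split.
  + by move=> x _; have [] := is_derive_normal_moment k x.
  + exact/cvg_at_right_filter/continuous_F.
  + exact/cvg_at_left_filter/continuous_F.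
- by move=> x _; rewrite derive1E; have [_ ->] := is_derive_normal_moment k x.
Qed.

(** Decay of order 1/|x|, enough for the boundary terms to vanish. *)
Let F_bound k (x : R) : `|x| * `|F k x| <= C k.+1.
Proof.
rewrite /F normrM normrX mulrA -exprS (ger0_norm (w_ge0 x)).
apply: le_trans (normal_moment_bound k.+1 x) _; rewrite ler_piMr //.
  by rewrite mulr_ge0 ?normal_peak_ge0 // addr_ge0 // mulr_ge0 ?exprn_ge0 ?ler0n.
by rewrite -expR0 ler_expR oppr_le0 divr_ge0 ?sqr_ge0.
Qed.

Let cvg_F k : (F k n.+1%:R - F k (- n.+1%:R)) @[n --> \oo] --> (0 : R).
Proof.
apply/norm_cvg0P; apply: (@squeeze_cvgr _ _ _ _ (cst 0) (fun n => 2 * C k.+1 * n.+1%:R^-1)).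
- apply: nearW => n /=; rewrite normr_ge0 /=.
  have n0 : 0 < n.+1%:R :> R by rewrite ltr0n.
  rewrite ler_pdivlMr // mulrC mulr_natl mulr2n.
  apply: le_trans (lerD (F_bound k n.+1%:R) (F_bound k (- n.+1%:R))).
  rewrite normrN -mulrDr (ger0_norm (ltW n0)) ler_wpM2l ?ler0n //.
  exact: ler_normB.
- exact: cvg_cst.
- rewrite -[X in _ --> X](mulr0 (2 * C k.+1)).
  by apply: cvgM; [exact: cvg_cst|exact: cvg_harmonic].
Qed.

(** [f k] is the derivative of [F k]. Its integral over [-n-1, n+1] is a difference of boundary
    terms tending to 0, and dominated convergence passes to the whole line. *)
Let integral_f k : (\int[mu]_x (f k x)%:E = 0)%E.
Proof.
pose D (n : nat) : set R := [set` `[- n.+1%:R, n.+1%:R : R]].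
have [] := @dominated_convergence _ _ _ mu setT measurableT
  (fun n => (EFin \o f k) \_ (D n)) (EFin \o f k) (abse \o (EFin \o f k)).
- move=> n; apply/measurable_restrict => //; first exact: measurable_itv.
  by rewrite setTI; apply: measurable_funTS; exact: (measurable_int _ (integrable_f k)).
- exact: (measurable_int _ (integrable_f k)).
- apply: aeW => x _; apply: cvg_near_cst.
  have [N _ HN] := nbhs_infty_ger `|x|.
  exists N => // n /= Nn; rewrite /patch mem_set // /D /= in_itv /=.
  have : `|x| <= n.+1%:R by apply: HN => /=; rewrite leqW.
  by rewrite ler_norml.
- exact: integrable_abse (integrable_f k).
- apply: aeW => x n _; rewrite /patch; case: ifP => // _.
  by rewrite abse0 /= lee_fin normr_ge0.
move=> _ _ cv.
have cv0 : (\int[mu]_x ((EFin \o f k) \_ (D n)) x)%E @[n --> \oo] --> (0 : \bar R).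
  under eq_fun do rewrite -integral_mkcond /D integral_itv_f.
  by apply: cvg_EFin; [exact: nearW|exact: cvg_F].
exact: (cvg_unique _ cv cv0).
Qed.

(** Integration by parts; for k = 0 it says that the first moment vanishes. *)
Lemma normal_moment_rec k :
  \int[mu]_x (x ^+ k.+1 * w x) = k%:R / 2 * \int[mu]_x (x ^+ k.-1 * w x).
Proof.
have H : \int[mu]_x (f k x) = 0 by rewrite /Rintegral integral_f.
have i1 := integrable_normal_moment k.-1.
have i2 := integrable_normal_moment k.+1.
have i1' := integrableZl measurableT k%:R i1.
have i2' := integrableZl measurableT 2 i2.
move: H; rewrite /f RintegralB // !RintegralZl // => /eqP; rewrite subr_eq0 => /eqP H.
by rewrite mulrAC H mulrAC divff ?mul1r.
Qed.

End GaussianMoments.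

(** * Expectations of functions of a Gaussian variable *)

Section GaussianVariable.
Local Open Scope classical_set_scope.
Local Open Scope ring_scope.
Variables (R : realType) (d : measure_display) (T : measurableType d).
Variables (P : probability T R) (X : {RV P >-> R}).
Let mu := @lebesgue_measure R.
Let sigma : R := Num.sqrt 2^-1.
Let w : R -> R := normal_pdf 0 sigma.
Hypothesis lawX : forall B, measurable B ->
  distribution P X B = normal_prob 0 sigma B.

Let mX : measurable_fun setT X.
Proof. exact: measurable_funP. Qed.

Let w0 x : 0 <= w x.
Proof. exact: normal_pdf_ge0. Qed.

Let mw : measurable_fun setT w.
Proof. exact: measurable_normal_pdf. Qed.

Lemma gaussian_integral_ge0 (f : R -> R) : measurable_fun setT f ->
  (forall x, 0 <= f x) ->
  (\int[P]_t (f (X t))%:E = \int[mu]_x (f x * w x)%:E)%E.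
Proof.
move=> mf f0.
transitivity (\int[P]_t (f (X t) * cst 1 t)%:E)%E.
  by apply: eq_integral => t _; rewrite mulr1.
apply: (@integral_indic_ext _ _ _ _ _ P mu X (cst 1) id w) => //.
move=> B mB; have mXB : measurable (X @^-1` B).
  by rewrite -[X in measurable X]setTI; exact: mX.
transitivity (P (X @^-1` B)).
  by rewrite -(setIT (X @^-1` B)) -integral_indic //;
    apply: eq_integral => t _; rewrite mulr1.
rewrite -[LHS]/(distribution P X B) lawX // /normal_prob [LHS]integral_mkcond.
apply: eq_integral => x _; rewrite /patch indicE; case: ifP => _.
  by rewrite mul1r.
by rewrite mul0r.
Qed.

Lemma gaussian_integral (f : R -> R) : measurable_fun setT f ->
  mu.-integrable setT (fun x => (f x * w x)%:E) ->
  P.-integrable setT (fun t => (f (X t))%:E) /\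
  \int[P]_t f (X t) = \int[mu]_x (f x * w x).
Proof.
move=> mf fi.
have ip : P.-integrable setT (fun t => (f (X t))%:E).
  apply/integrableP; split; first by apply/measurable_EFinP/measurableT_comp.
  rewrite (@gaussian_integral_ge0 (fun x => `|f x|)) //; last exact: measurableT_comp.
  have /integrableP[_] := fi; congr (_ < _)%E.
  by apply: eq_integral => x _ /=; rewrite normrM (ger0_norm (w0 x)).
split=> //.
have posE x : (f^\+ x * w x) = (fun x => f x * w x)^\+ x.
  by rewrite /funrpos maxr_pMl // mul0r.
have negE x : (f^\- x * w x) = (fun x => f x * w x)^\- x.
  by rewrite /funrneg maxr_pMl // mul0r mulNr.
have Ep : \int[P]_t f^\+ (X t) = \int[mu]_x ((fun x => f x * w x)^\+ x).
  rewrite /Rintegral gaussian_integral_ge0 //; last exact: measurable_funrpos.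
  by congr fine; apply: eq_integral => x _; rewrite posE.
have En : \int[P]_t f^\- (X t) = \int[mu]_x ((fun x => f x * w x)^\- x).
  rewrite /Rintegral gaussian_integral_ge0 //; last exact: measurable_funrneg.
  by congr fine; apply: eq_integral => x _; rewrite negE.
transitivity (\int[P]_t f^\+ (X t) - \int[P]_t f^\- (X t)).
  rewrite -RintegralB //.
  - by apply: eq_Rintegral => t _; rewrite -[in LHS](funrposBneg f).
  - exact: (integrable_funrpos measurableT ip).
  - exact: (integrable_funrneg measurableT ip).
rewrite Ep En -RintegralB //.
- apply: eq_Rintegral => x _.
  exact: (congr1 (@^~ x) (funrposBneg (fun x => f x * w x))).
- exact: (integrable_funrpos measurableT fi).
- exact: (integrable_funrneg measurableT fi).
Qed.

Lemma gaussian_moment_integrable k : P.-integrable setT (fun t => (X t ^+ k)%:E).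
Proof.
by have [] := @gaussian_integral (fun x => x ^+ k) _ (integrable_normal_moment R k);
  first exact: measurable_funX.
Qed.

Let moment k : R := \int[P]_t (X t ^+ k).

Lemma gaussian_moment_rec k : moment k.+1 = k%:R / 2 * moment k.-1.
Proof.
rewrite /moment.
have E j := proj2 (@gaussian_integral (fun x => x ^+ j)
  (measurable_funX _ (@measurable_id _ _ _)) (integrable_normal_moment R j)).
by rewrite !E normal_moment_rec.
Qed.

End GaussianVariable.

(** * Gaussian integration by parts for words in independent variables *)

Section Stein.
Local Open Scope classical_set_scope.
Local Open Scope ring_scope.
Variables (R : realType) (d : measure_display) (T : measurableType d).
Variables (P : probability T R) (I : finType) (X : I -> {RV P >-> R}).
Hypothesis indX : mutually_independent X.
Hypothesis lawX : forall i (B : set R), measurable B ->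
  distribution P (X i) B = normal_prob 0 (Num.sqrt 2^-1) B.

Let M i k : R := \int[P]_t (X i t ^+ k).

Lemma monomial_moment (a : I -> nat) :
  P.-integrable setT (fun t => (\prod_i X i t ^+ a i)%:E) /\
  \int[P]_t (\prod_i X i t ^+ a i) = \prod_i M i (a i).
Proof.
apply: (@independent_product _ _ _ _ _ _ indX (fun i x => x ^+ a i)) => i.
  by apply: measurable_funX; exact: measurable_id.
exact: (gaussian_moment_integrable (lawX i)).
Qed.

Variable K : finType.
Implicit Types (f : K -> I) (Q : pred K).

Lemma word_monomial f Q t : \prod_(j | Q j) X (f j) t =
  \prod_i X i t ^+ #|[pred j | Q j & f j == i]|.
Proof.
rewrite (partition_big f xpredT) //=; apply: eq_bigr => i _.
by rewrite -prodr_const; apply: eq_bigr => j /andP[_ /eqP->].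
Qed.

Lemma word_integrable f Q :
  P.-integrable setT (fun t => (\prod_(j | Q j) X (f j) t)%:E).
Proof.
under eq_fun do rewrite word_monomial.
exact: (proj1 (monomial_moment _)).
Qed.

(** A word is a monomial in the variables. The moment recursion at z, whose exponent is c z + 1,
    gives the factor c z / 2, and each of the c z positions j with f j = z contributes the same
    expectation. *)
Lemma real_stein f z :
  P.-integrable setT (fun t => (X z t * \prod_j X (f j) t)%:E) /\
  \int[P]_t (X z t * \prod_j X (f j) t) =
  2^-1 * \sum_(j | f j == z) \int[P]_t \prod_(k | k != j) X (f k) t.
Proof.
pose c i := #|[pred j | f j == i]|.
have E t : X z t * \prod_j X (f j) t = \prod_i X i t ^+ (c i + (i == z)).
  rewrite (word_monomial f xpredT) (bigD1 z) // [RHS](bigD1 z) //= eqxx addn1 exprS -mulrA.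
  by congr (_ * (_ * _)); apply: eq_bigr => i /negbTE ->; rewrite addn0.
have -> : (fun t => (X z t * \prod_j X (f j) t)%:E) =
          (fun t => (\prod_i X i t ^+ (c i + (i == z)))%:E).
  by apply/funext => t; rewrite E.
split; first exact: (proj1 (monomial_moment _)).
under eq_Rintegral do rewrite E.
rewrite (proj2 (monomial_moment _)) (bigD1 z) //= eqxx addn1.
rewrite /M (gaussian_moment_rec (lawX z)) -/(M z _).
have term j : f j = z -> \int[P]_t \prod_(k | k != j) X (f k) t =
    M z (c z).-1 * \prod_(i | i != z) M i (c i + (i == z)).
  move=> fj; under eq_Rintegral do rewrite word_monomial.
  rewrite (proj2 (monomial_moment _)) (bigD1 z) //=; congr (M z _ * _).
    rewrite /c (cardD1 j [pred k | f k == z]) inE fj eqxx add1n /=.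
    by apply: eq_card => k; rewrite !inE.
  apply: eq_bigr => i iz; rewrite (negbTE iz) addn0; congr (M i _).
  apply: eq_card => k; rewrite !inE; case: eqVneq => //= ->.
  by rewrite fj eq_sym (negbTE iz).
rewrite [in RHS](eq_bigr (fun=> M z (c z).-1 * \prod_(i | i != z) M i (c i + (i == z)))).
  by rewrite sumr_const -/(c z) mulrnAr -[RHS]mulr_natl -!mulrA.
by move=> j /eqP; exact: term.
Qed.

(** The expectation is taken on real and imaginary parts, so complex linearity is established for
    complex combinations of real integrable variables. *)
Lemma complex_expectation_sum (J : finType) (C : J -> R[i]) (Y : J -> T -> R) :
  (forall j, P.-integrable setT (fun t => (Y j t)%:E)) ->
  complex_expectation P (fun t => \sum_j C j * (Y j t)%:C) =
  \sum_j C j * (\int[P]_t Y j t)%:C.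
Proof.
move=> Yi.
have ReE t : complex.Re (\sum_j C j * (Y j t)%:C) = \sum_j complex.Re (C j) * Y j t.
  rewrite raddf_sum; apply: eq_bigr => j _.
  by case: (C j) => a b /=; rewrite !mulr0 subr0.
have ImE t : complex.Im (\sum_j C j * (Y j t)%:C) = \sum_j complex.Im (C j) * Y j t.
  rewrite raddf_sum; apply: eq_bigr => j _.
  by case: (C j) => a b /=; rewrite !mulr0 add0r.
have int_sum (a : J -> R) : fine ('E_P[fun t => (\sum_j a j * Y j t)%R])%E =
    \sum_j a j * \int[P]_t Y j t.
  rewrite unlock; under eq_integral do rewrite -sumEFin.
  rewrite integral_sum //; last by move=> j; exact: (integrableZl measurableT _ (Yi j)).
  rewrite (eq_bigr (fun j => (a j * \int[P]_t Y j t)%:E)); first by rewrite sumEFin.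
  move=> j _; rewrite -(RintegralZl _ measurableT (Yi j)).
  apply/esym/(@EFin_Rintegral _ _ _ P (fun t => a j * Y j t)).
  exact: (integrableZl measurableT _ (Yi j)).
rewrite /complex_expectation.
have -> : (fun t => complex.Re (\sum_j C j * (Y j t)%:C)) =
    (fun t => \sum_j complex.Re (C j) * Y j t) by apply/funext.
have -> : (fun t => complex.Im (\sum_j C j * (Y j t)%:C)) =
    (fun t => \sum_j complex.Im (C j) * Y j t) by apply/funext.
rewrite !int_sum; apply/eqP; rewrite eq_complex; apply/andP; split; apply/eqP.
  rewrite /= raddf_sum; apply: eq_bigr => j _.
  by case: (C j) => a b /=; rewrite !mulr0 subr0.
rewrite /= raddf_sum; apply: eq_bigr => j _.
by case: (C j) => a b /=; rewrite !mulr0 add0r.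
Qed.

End Stein.

(** A permutation amounts to the preimage j of [ord0] and a bijection between the remaining
    points. *)
Lemma sum_lift_perm (V : nmodType) p (F : 'S_p.+1 -> V) :
  \sum_s F s = \sum_j \sum_(s : 'S_p) F (lift_perm j ord0 s).
Proof.
rewrite pair_big /=; pose h (js : 'I_p.+1 * 'S_p) := lift_perm js.1 ord0 js.2.
rewrite (reindex h) //; apply: onW_bij; apply: inj_card_bij.
  move=> [j s] [j' s'] /= E.
  have jj : j = j'.
    apply: (@perm_inj _ (h (j, s))); rewrite {2}E /h /= !lift_perm_id //.
  subst j'; congr pair; apply/permP => k; apply: (@lift_inj _ ord0).
  by have := congr1 (fun s : 'S_p.+1 => s (lift j k)) E; rewrite /h /= !lift_perm_lift.
by rewrite card_prod !card_Sn card_ord factS.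
Qed.

Lemma prod_lift (K : comPzSemiRingType) n (j : 'I_n.+1) (F : 'I_n.+1 -> K) :
  \prod_(k | k != j) F k = \prod_k F (lift j k).
Proof.
rewrite (reindex_omap (lift j) (unlift j)) /=; last first.
  by move=> k; case: unliftP => [k' ->|->] //; rewrite eqxx.
by apply: eq_bigl => k; rewrite liftK eqxx andbT eq_sym neq_lift.
Qed.

(** * Complex linear combinations of Gaussian words *)

Section Wick.
Variables (R : realType) (d : measure_display) (T : measurableType d).
Variables (P : probability T R) (I : finType) (X : I -> {RV P >-> R}).
Hypothesis indX : mutually_independent X.
Hypothesis lawX : forall i (B : set R), measurable B ->
  distribution P (X i) B = normal_prob 0 (Num.sqrt 2^-1) B.

Section ComplexStein.
Variable K : finType.
Implicit Types (c : K -> I -> R[i]) (Q : pred K).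

(** Positions outside Q are pinned to the dummy value z0, so that the expansion runs over functions
    on all of K for every Q. *)
Let wt c Q z0 (f : {ffun K -> I}) : R[i] :=
  \prod_j if Q j then c j (f j) else (f j == z0)%:R.

Lemma prod_linear_expand c Q z0 t :
  \prod_(j | Q j) \sum_z c j z * (X z t)%:C =
  \sum_f wt c Q z0 f * (\prod_(j | Q j) X (f j) t)%:C.
Proof.
transitivity (\prod_j \sum_z if Q j then c j z * (X z t)%:C else (z == z0)%:R).
  rewrite big_mkcond; apply: eq_bigr => j _; case: ifP => // _.
  by rewrite (bigD1 z0) //= eqxx big1 ?addr0 // => z /negbTE ->.
rewrite bigA_distr_bigA; apply: eq_bigr => f _.
rewrite [X in X%:C]big_mkcond rmorph_prod -big_split /=; apply: eq_bigr => j _.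
by case: ifP => // _; rewrite mulr1.
Qed.

Lemma complex_expectation_prod_linear c Q z0 :
  complex_expectation P (fun t => \prod_(j | Q j) \sum_z c j z * (X z t)%:C) =
  \sum_f wt c Q z0 f * (\int[P]_t \prod_(j | Q j) X (f j) t)%:C.
Proof.
rewrite -complex_expectation_sum; last by move=> f; exact: word_integrable.
by congr complex_expectation; apply/funext => t; exact: prod_linear_expand.
Qed.

(** Linear extension of [real_stein] in every letter; the covariance of two letters is bilinear,
    without conjugation. *)
Lemma complex_stein c (v : I -> R[i]) :
  complex_expectation P (fun t => (\sum_z v z * (X z t)%:C) *
    \prod_j \sum_z c j z * (X z t)%:C) =
  2^-1 * \sum_j (\sum_z v z * c j z) *
    complex_expectation P (fun t => \prod_(k | k != j) \sum_z c k z * (X z t)%:C).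
Proof.
pose C (zf : I * {ffun K -> I}) := v zf.1 * \prod_j c j (zf.2 j).
pose Y (zf : I * {ffun K -> I}) t := X zf.1 t * \prod_j X (zf.2 j) t.
transitivity (complex_expectation P (fun t => \sum_zf C zf * (Y zf t)%:C)).
  congr complex_expectation; apply/funext => t.
  rewrite bigA_distr_bigA big_distrlr /= pair_bigA; apply: eq_bigr => -[z f] _ /=.
  rewrite /C /Y /= rmorphM rmorph_prod big_split /= mulrACA.
  by [].
rewrite complex_expectation_sum; last first.
  by move=> [z f]; exact: (proj1 (real_stein indX lawX f z)).
rewrite -(pair_bigA _ (fun z f => C (z, f) * (\int[P]_t Y (z, f) t)%:C)) /=.
under eq_bigr => z _ do under eq_bigr => f _ do
  rewrite /Y /= (proj2 (real_stein indX lawX f z)).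
rewrite mulr_sumr.
under [RHS]eq_bigr => j _ do rewrite mulr_suml mulr_sumr.
rewrite [RHS]exchange_big /=; apply: eq_bigr => z _.
pose e j f := (\int[P]_t \prod_(k | k != j) X ((f : {ffun K -> I}) k) t)%:C : R[i].
have half : (2^-1 : R)%:C = 2^-1 :> R[i] by rewrite fmorphV rmorph_nat.
transitivity (\sum_f \sum_j 2^-1 * C (z, f) * ((f j == z)%:R * e j f)).
  apply: eq_bigr => f _; rewrite rmorphM /= -mulr_sumr half.
  rewrite mulrCA mulrA; congr (_ * _); rewrite rmorph_sum /= big_mkcond /=.
  by apply: eq_bigr => j _; case: (f j == z); rewrite ?mul1r ?mul0r.
rewrite exchange_big /=; apply: eq_bigr => j _.
(* The dummy value is chosen as z, so that the pinned position j reproduces the condition f j =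
   z. *)
rewrite (complex_expectation_prod_linear _ _ z) !mulr_sumr; apply: eq_bigr => f _.
rewrite -!mulrA; congr (_ * _); rewrite /C /= !mulrA -/(e j f); congr (_ * _).
rewrite /wt (bigD1 j) //= [in RHS](bigD1 j) //= eqxx /= -!mulrA; congr (_ * _).
have [fj|_] := eqVneq (f j) z; last by rewrite mul0r !mulr0.
rewrite fj mulr1 mul1r; congr (_ * _); apply: eq_bigr => k kj.
by rewrite kj.
Qed.

Lemma complex_expectation_words (J : finType) (C : J -> R[i]) (c : J -> K -> I -> R[i])
    (z0 : I) :
  complex_expectation P (fun t => \sum_j C j * \prod_k \sum_z c j k z * (X z t)%:C) =
  \sum_j C j * complex_expectation P (fun t => \prod_k \sum_z c j k z * (X z t)%:C).
Proof.
pose Y (f : {ffun K -> I}) t := \prod_k X (f k) t.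
transitivity (complex_expectation P (fun t =>
    \sum_f (\sum_j C j * wt (c j) xpredT z0 f) * (Y f t)%:C)).
  congr complex_expectation; apply/funext => t.
  under eq_bigr => j _ do rewrite (prod_linear_expand (c j) xpredT z0) mulr_sumr.
  rewrite exchange_big /=; apply: eq_bigr => f _; rewrite mulr_suml.
  by apply: eq_bigr => j _; rewrite mulrA.
rewrite complex_expectation_sum; last by move=> f; exact: word_integrable.
under [RHS]eq_bigr => j _ do
  rewrite (complex_expectation_prod_linear (c j) xpredT z0) mulr_sumr.
rewrite [RHS]exchange_big /=; apply: eq_bigr => f _; rewrite mulr_suml.
by apply: eq_bigr => j _; rewrite mulrA.
Qed.

End ComplexStein.

Lemma complex_expectation1 : complex_expectation P (fun=> 1) = 1.
Proof.
have -> : (fun=> 1) = (fun t : T => \sum_(j < 1) 1 * (1 : R)%:C) :> (T -> R[i]).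
  by apply/funext => t; rewrite big_ord1 mul1r.
rewrite complex_expectation_sum.
  rewrite big_ord1 mul1r Rintegral_cst // mul1r (_ : fine _ = 1) //.
  by rewrite -[RHS]/(fine 1%E); congr fine; exact: probability_setT.
by move=> j; exact: (finite_measure_integrable_cst P 1 measurableT).
Qed.

End Wick.

(** In a pairing of two letters the real and imaginary contributions cancel when both or neither are
    conjugated, and add up otherwise; u stands for i. *)
Lemma imaginary_unit_pairings (K : comPzRingType) (b u : K) : u * u = -1 ->
  [/\ b + u * (b * u) = 0, b + - u * (b * - u) = 0,
      b + u * (b * - u) = b * 2 & b + - u * (b * u) = b * 2].
Proof.
move=> uu.
have e : u * (b * u) = - b by rewrite mulrCA uu mulrN1.
by split; rewrite ?mulrN ?mulNr ?mulrN ?opprK e ?opprK ?subrr // mulr_natr mulr2n.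
Qed.

(** * Wick's formula for complex Gaussian entries *)

Section ComplexGaussianWick.
Variables (R : realType) (d : measure_display) (T : measurableType d).
Variables (P : probability T R) (E : finType) (X : E * bool -> {RV P >-> R}).
Hypothesis indX : mutually_independent X.
Hypothesis lawX : forall i (B : set R), measurable B ->
  distribution P (X i) B = normal_prob 0 (Num.sqrt 2^-1) B.

Definition gaussian_entry (x : E) (t : T) : R[i] := X (x, false) t +i* X (x, true) t.

Let co (eps : bool) (x : E) (z : E * bool) : R[i] :=
  (z.1 == x)%:R * (if z.2 then (if eps then - 'i else 'i) else 1).

Let letter eps x t : R[i] :=
  if eps then (gaussian_entry x t)^* else gaussian_entry x t.

Let letterE eps x t : letter eps x t = \sum_z co eps x z * (X z t)%:C.
Proof.
have tf : (x, true) != (x, false) by rewrite xpair_eqE eqxx.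
rewrite (bigD1 (x, false)) //= (bigD1 (x, true)) //= big1 => [|[x' b]].
  rewrite /co /= eqxx mul1r /letter /gaussian_entry addr0 !mul1r.
  by case: eps; apply/eqP; rewrite eq_complex /=; apply/andP; split; apply/eqP; ring.
case/andP; rewrite !xpair_eqE /co /=; case: eqVneq => /= [_|_ _ _]; last by rewrite !mul0r.
by case: b.
Qed.

(** Only an entry and its own conjugate have nonzero covariance; the 2 cancels against the variance
    1/2. *)
Let co_pair eps eps' x y : \sum_z co eps x z * co eps' y z =
  if eps == eps' then 0 else (x == y)%:R * 2.
Proof.
have tf : (x, true) != (x, false) by rewrite xpair_eqE eqxx.
rewrite (bigD1 (x, false)) //= (bigD1 (x, true)) //= big1 => [|[x' b]].
  rewrite /co /= eqxx !mul1r !mulr1 addr0.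
  have ii : 'i * 'i = -1 :> R[i] by rewrite -expr2 sqrCi.
  have [e1 e2 e3 e4] := imaginary_unit_pairings (x == y)%:R ii.
  by case: eps; case: eps'.
case/andP; rewrite !xpair_eqE /co /=; case: eqVneq => /= [_|_ _ _]; last by rewrite !mul0r.
by case: b.
Qed.

(** Induction by integration by parts in the first unconjugated entry. It pairs with some conjugated
    y j, and j becomes the preimage of [ord0] under s, the rest of s coming from the shorter
    words. *)
Lemma wick p (x y : 'I_p -> E) :
  complex_expectation P (fun t => \prod_k gaussian_entry (x k) t *
                                  \prod_k (gaussian_entry (y k) t)^* ) =
  \sum_(s : 'S_p) \prod_k (y k == x (s k))%:R.
Proof.
elim: p x y => [|p IH] x y.
  rewrite [RHS](big_pred1 1%g) => [|s]; last first.
    by apply/esym/eqP/permP => -[].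
  rewrite big_ord0 -[RHS](complex_expectation1 P); congr complex_expectation.
  by apply/funext => t; rewrite !big_ord0 mulr1.
pose c (j : 'I_p + 'I_p.+1) :=
  match j with inl k => co false (x (lift ord0 k)) | inr k => co true (y k) end.
transitivity (complex_expectation P (fun t => (\sum_z co false (x ord0) z * (X z t)%:C) *
    \prod_j \sum_z c j z * (X z t)%:C)).
  congr complex_expectation; apply/funext => t; rewrite big_ord_recl -mulrA.
  rewrite -letterE /letter /=; congr (_ * _); rewrite big_sumType /=; congr (_ * _).
    by apply: eq_bigr => k _; rewrite -letterE.
  by apply: eq_bigr => k _; rewrite -letterE.
rewrite complex_stein // big_sumType /= big1 ?add0r; last first.
  by move=> k _; rewrite co_pair mul0r.
rewrite sum_lift_perm mulr_sumr; apply: eq_bigr => j _; rewrite co_pair /=.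
transitivity (\sum_(s : 'S_p) (x ord0 == y j)%:R *
    \prod_k (y (lift j k) == x (lift ord0 (s k)))%:R : R[i]); last first.
  apply: eq_bigr => s _; rewrite (bigD1_ord j) //= lift_perm_id eq_sym; congr (_ * _).
  by apply: eq_bigr => k _; rewrite lift_perm_lift.
have IHj := IH (fun k => x (lift ord0 k)) (fun k => y (lift j k)).
rewrite -mulr_sumr -IHj mulrC mulrAC mulfK ?pnatr_eq0 //; congr (_ * _).
congr complex_expectation; apply/funext => t; rewrite big_sumType /=; congr (_ * _).
  by apply: eq_big => // k _; rewrite -letterE.
rewrite (eq_bigl (fun k => k != j)) // prod_lift.
by apply: eq_bigr => k _; rewrite -letterE.
Qed.

Lemma wick_linear p (e0 : E) (J : finType) (C : J -> R[i]) (x y : J -> 'I_p -> E) :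
  complex_expectation P (fun t => \sum_j C j *
    (\prod_k gaussian_entry (x j k) t * \prod_k (gaussian_entry (y j k) t)^* )) =
  \sum_j C j * \sum_(s : 'S_p) \prod_k (y j k == x j (s k))%:R.
Proof.
pose c j (k : 'I_p + 'I_p) :=
  match k with inl k => co false (x j k) | inr k => co true (y j k) end.
have E1 j t : \prod_k gaussian_entry (x j k) t * \prod_k (gaussian_entry (y j k) t)^* =
    \prod_k \sum_z c j k z * (X z t)%:C.
  rewrite big_sumType /=; congr (_ * _); by apply: eq_bigr => k _; rewrite -letterE.
transitivity (\sum_j C j * complex_expectation P (fun t => \prod_k \sum_z c j k z * (X z t)%:C)).
  rewrite -(complex_expectation_words indX lawX C c (e0, false)).
  by congr complex_expectation; apply/funext => t; apply: eq_bigr => j _; rewrite E1.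
apply: eq_bigr => j _; rewrite -wick; congr (_ * complex_expectation _ _).
by apply/funext => t; rewrite E1.
Qed.

End ComplexGaussianWick.

(** * Entries and self-adjointness of the block-modified matrix *)

Section Matrices.
Variable R : realType.

Lemma block_mapE d n (f : 'M[R[i]]_n -> 'M[R[i]]_n) (W : 'M[R[i]]_(d * n)) i b j c :
  block_map f W (mxtens_index (i, b)) (mxtens_index (j, c)) =
  f (\matrix_(a, a') W (mxtens_index (i, a)) (mxtens_index (j, a'))) b c.
Proof.
rewrite /block_map summxE (bigD1 i) //= [X in _ + X]big1 ?addr0; last first.
  move=> i' ii; rewrite summxE big1 // => j' _.
  by rewrite tensmxE mxE eq_sym (negbTE ii) mul0r.
rewrite summxE (bigD1 j) //= [X in _ + X]big1 ?addr0; last first.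
  by move=> j' jj; rewrite tensmxE mxE [j == _]eq_sym (negbTE jj) andbF mul0r.
by rewrite tensmxE mxE !eqxx mul1r.
Qed.

Lemma law_selfadjoint n (A : 'M[R[i]]_n) e : adjmx A = A ->
  law A e = \tr (A ^+ size e) / n%:R.
Proof.
move=> sA; rewrite /law; congr (\tr _ / _).
by elim: e => [|b e IH]; rewrite ?big_nil // big_cons IH exprS sA; case: b.
Qed.

Variables (s N : nat) (p : {set {set row_point (s + s)%N (s + s)%N}}).
Let n := (N ^ s)%N.
Hypothesis p_sym : p = pcirc p.

Lemma adjmx_Lambda : adjmx (Lambda (@phi R s N p)) = Lambda (@phi R s N p).
Proof.
apply/matrixP => x y; case: (mxtens_indexP x) => a b; case: (mxtens_indexP y) => c d.
by rewrite !mxE !LambdaE conjC_nat (delta4_swap p_sym).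
Qed.

(** The normalisation m / (dm) leaves 1/d. The index h consists of a position inside an n x n block
    and of the index summed over in the matrix product. *)
Lemma wishart_blockE (d m : nat) (G : 'M[R[i]]_(d * n, d * m)) i b j c :
  (0 < m)%N ->
  (m%:R *: block_map (phi p) ((d * m)%:R^-1 *: (G *m adjmx G)))
    (mxtens_index (i, b)) (mxtens_index (j, c)) =
  d%:R^-1 * \sum_(h : 'I_n * 'I_n * 'I_(d * m))
    (delta4 p h.1.1 h.1.2 b c)%:R *
    (G (mxtens_index (i, h.1.1)) h.2 * (G (mxtens_index (j, h.1.2)) h.2)^* ).
Proof.
move=> m0; rewrite mxE block_mapE phiE.
have m0' : m%:R != 0 :> R[i] by rewrite pnatr_eq0 -lt0n.
have d0 : d%:R != 0 :> R[i] by rewrite pnatr_eq0; case: (d) i => // -[].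
have dm0 : (d * m)%:R != 0 :> R[i] by rewrite natrM mulf_neq0.
have -> : m%:R = d%:R^-1 * (d * m)%:R :> R[i] by rewrite natrM mulKf.
rewrite -mulrA; congr (_ * _).
rewrite -(pair_bigA _ (fun (ac : 'I_n * 'I_n) (k : 'I_(d * m)) =>
  (delta4 p ac.1 ac.2 b c)%:R *
    (G (mxtens_index (i, ac.1)) k * (G (mxtens_index (j, ac.2)) k)^* ))) /=.
rewrite -(pair_bigA _ (fun a a' => \sum_k (delta4 p a a' b c)%:R *
    (G (mxtens_index (i, a)) k * (G (mxtens_index (j, a')) k)^* ))) /=.
rewrite mulr_sumr; apply: eq_bigr => a _; rewrite mulr_sumr; apply: eq_bigr => a' _.
rewrite !mxE mulrA mulVKf // mulrC -mulr_sumr; congr (_ * _).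
by apply: eq_bigr => k _; rewrite !mxE.
Qed.

Lemma wishart_block_selfadjoint (d m : nat) (G : 'M[R[i]]_(d * n, d * m)) :
  (0 < m)%N ->
  let A := m%:R *: block_map (@phi R s N p) ((d * m)%:R^-1 *: (G *m adjmx G)) in
  adjmx A = A.
Proof.
move=> m0 A; apply/matrixP => x y.
case: (mxtens_indexP x) => i b; case: (mxtens_indexP y) => j c.
rewrite [LHS]mxE [LHS]mxE !wishart_blockE // -[LHS]/(conjc _).
rewrite rmorphM fmorphV /= conjc_nat; congr (_ * _).
rewrite rmorph_sum (reindex (fun h => (h.1.2, h.1.1, h.2))) /=; last first.
  by apply: onW_bij; exists (fun h => (h.1.2, h.1.1, h.2)) => -[[? ?] ?].
apply: eq_bigr => -[[a a'] k] _ /=.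
by rewrite !rmorphM /= conjc_nat (delta4_swap p_sym) conjcK [X in _ * X]mulrC.
Qed.

End Matrices.

(** * Genus expansion of the moments *)

Section ExpectedMoments.
Variables (R : realType) (s N : nat) (p : {set {set row_point (s + s)%N (s + s)%N}}).
Let n := (N ^ s)%N.
Hypothesis p_sym : p = pcirc p.
Hypothesis N_gt0 : (0 < N)%N.

(** The sum splits over the coordinates. Outer block indices are constant on the cycles of t^-1 g,
    up to reindexing, and columns on those of t, which gives the powers of d and M. The remaining
    Kronecker symbols eliminate one inner index and leave a contraction of copies of [Lambda]. *)
Lemma sum_contractions (d M q : nat) (t : 'S_q.+1) : (0 < d)%N -> (0 < M)%N ->
  let g := ord_cycle q.+1 in
  \sum_(f : {ffun 'I_q.+1 -> 'I_d * 'I_n})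
    \sum_(h : {ffun 'I_q.+1 -> 'I_n * 'I_n * 'I_M})
      (\prod_k (delta4 p (h k).1.1 (h k).1.2 (f k).2 (f (g k)).2)%:R) *
      \prod_k ((mxtens_index ((f (g k)).1, (h k).1.2), (h k).2) ==
               (mxtens_index ((f (t k)).1, (h (t k)).1.1), (h (t k)).2))%:R =
  d%:R ^+ #|porbits (t^-1 * g)%g| * M%:R ^+ #|porbits t| *
  tensor_contraction (tensor_power (Lambda (@phi R s N p))) g t (fun=> 1%N).
Proof.
move=> d0 M0 g.
transitivity (\sum_(i : {ffun 'I_q.+1 -> 'I_d}) \sum_(b : {ffun 'I_q.+1 -> 'I_n})
  \sum_(a : {ffun 'I_q.+1 -> 'I_n}) \sum_(c : {ffun 'I_q.+1 -> 'I_n})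
  \sum_(k : {ffun 'I_q.+1 -> 'I_M})
  \prod_x ((i (g x) == i (t x))%:R * (k (t x) == k x)%:R *
    ((c x == a (t x))%:R * (delta4 p (a x) (c x) (b x) (b (g x)))%:R)) : R[i]).
  rewrite sum_ffun_pair; apply: eq_bigr => i _; apply: eq_bigr => b _.
  rewrite sum_ffun_pair; rewrite sum_ffun_pair; apply: eq_bigr => a _; apply: eq_bigr => c _.
  apply: eq_bigr => k _; rewrite -big_split /=; apply: eq_bigr => x _.
  rewrite !ffunE /= xpair_eqE (can_eq (@mxtens_indexK d n)) xpair_eqE.
  by rewrite [k x == _]eq_sym; do 3 (case: eqP => _ /=); rewrite ?(mulr0, mulr1, mul0r, mul1r).
pose Si := \sum_(i : {ffun 'I_q.+1 -> 'I_d}) \prod_x (i (g x) == i (t x))%:R : R[i].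
pose Sk := \sum_(k : {ffun 'I_q.+1 -> 'I_M}) \prod_x (k (t x) == k x)%:R : R[i].
transitivity (Si * (Sk * tensor_contraction (tensor_power (Lambda (@phi R s N p))) g t (fun=> 1%N))).
  rewrite mulr_suml; apply: eq_bigr => i _.
  rewrite /tensor_contraction exchange_big /= !mulr_sumr; apply: eq_bigr => a _.
  rewrite !mulr_sumr; apply: eq_bigr => b _; rewrite exchange_big /=.
  rewrite mulr_suml mulr_sumr; apply: eq_bigr => k _.
  under eq_bigr => c _ do rewrite big_split /=.
  rewrite -mulr_sumr [X in X * _]big_split /= mulrA; congr (_ * _).
  rewrite -(bigA_distr_bigA (fun x c => (c == a (t x))%:R * (delta4 p (a x) c (b x) (b (g x)))%:R)).
  apply: eq_bigr => x _; rewrite (bigD1 (a (t x))) //= eqxx mul1r big1 ?addr0.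
    by rewrite /tensor_power expr1 LambdaE.
  by move=> c /negbTE->; rewrite mul0r.
rewrite mulrA; congr (_ * _ * _).
  rewrite /Si -[in RHS](card_ord d) -count_fixed_functions ?card_ord //.
  apply: eq_bigr => i _; rewrite (reindex_inj (@perm_inj _ t^-1%g)) /=.
  by apply: eq_bigr => x _; rewrite permM permKV.
by rewrite /Sk count_fixed_functions ?card_ord.
Qed.

(** The part of the Wick term of t that does not depend on d; 1/n comes from the normalised
    trace. *)
Definition genus_weight m q (t : 'S_q.+1) : R[i] :=
  n%:R^-1 * m%:R ^+ #|porbits t| *
  tensor_contraction (tensor_power (Lambda (@phi R s N p))) (ord_cycle q.+1) t (fun=> 1%N).

Lemma expected_moment (disp : measure_display) (T : measurableType disp)
    (P : probability T R) (d m : nat) (W : T -> 'M[R[i]]_(d * n)) e q :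
  (0 < d)%N -> (0 < m)%N -> size e = q.+1 -> complex_wishart P (d * m) W ->
  complex_expectation P (fun t => law (m%:R *: block_map (phi p) (W t)) e) =
  \sum_(t : 'S_q.+1) genus_weight m t *
    (d%:R ^+ (#|porbits (t^-1 * ord_cycle q.+1)%g| + #|porbits t|) / d%:R ^+ q.+2).
Proof.
move=> d0 m0 eq [G [[X [indX lawX GX]] WG]].
set g := ord_cycle q.+1.
have n0 : (0 < n)%N by rewrite expn_gt0 N_gt0.
have dn0 : (0 < d * n)%N by rewrite muln_gt0 d0.
have dm0 : (0 < d * m)%N by rewrite muln_gt0 d0.
have Gent t x k : G t x k = gaussian_entry X (x, k) t by rewrite GX.
pose J := ({ffun 'I_q.+1 -> 'I_d * 'I_n} * {ffun 'I_q.+1 -> 'I_n * 'I_n * 'I_(d * m)})%type.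
pose C (j : J) : R[i] := (d * n)%:R^-1 * d%:R^-1 ^+ q.+1 *
  \prod_k (delta4 p (j.2 k).1.1 (j.2 k).1.2 (j.1 k).2 (j.1 (g k)).2)%:R.
pose x (j : J) k := (mxtens_index ((j.1 k).1, (j.2 k).1.1), (j.2 k).2).
pose y (j : J) k := (mxtens_index ((j.1 (g k)).1, (j.2 k).1.2), (j.2 k).2).
transitivity (complex_expectation P (fun t => \sum_j C j *
    (\prod_k gaussian_entry X (x j k) t * \prod_k (gaussian_entry X (y j k) t)^* ))).
  congr complex_expectation; apply/funext => t.
  rewrite WG law_selfadjoint ?wishart_block_selfadjoint // eq trace_exp_sum // -/g.
  rewrite mulrC mulr_sumr.
  rewrite -(pair_bigA _ (fun f h => C (f, h) *
    (\prod_k gaussian_entry X (x (f, h) k) t *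
     \prod_k (gaussian_entry X (y (f, h) k) t)^* ))) /=.
  apply: eq_bigr => f _.
  under eq_bigr => k _ do rewrite [f k]surjective_pairing [f (g k)]surjective_pairing wishart_blockE //.
  rewrite big_split /= prodr_const card_ord mulrA bigA_distr_bigA mulr_sumr.
  apply: eq_bigr => h _; rewrite /C /= -[RHS]mulrA; congr (_ * _).
  rewrite -!big_split /=; apply: eq_bigr => k _.
  by rewrite !Gent.
rewrite (wick_linear indX lawX (mxtens_index (Ordinal d0, Ordinal n0), Ordinal dm0)).
under eq_bigr => j _ do rewrite mulr_sumr.
rewrite exchange_big /=; apply: eq_bigr => t _.
(* The normalised trace gives 1/(dn) and each of the q + 1 factors gives 1/d, whence the denominator
   d^(q+2). *)
transitivity ((d * n)%:R^-1 * d%:R^-1 ^+ q.+1 * (d%:R ^+ #|porbits (t^-1 * g)%g| *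
    (d * m)%:R ^+ #|porbits t| *
    tensor_contraction (tensor_power (Lambda (@phi R s N p))) g t (fun=> 1%N))).
  rewrite -sum_contractions // pair_bigA mulr_sumr; apply: eq_bigr => -[f h] _.
  by rewrite /C /x /y /= mulrA.
have dR : d%:R != 0 :> R[i] by rewrite pnatr_eq0 -lt0n.
rewrite /genus_weight -/g exprD [d%:R ^+ q.+2]exprS exprVn !natrM exprMn !invfM.
by rewrite [LHS](AC (3*((1*2)*1)) ((2*6*7)*(4*5*(1*3)))).
Qed.

(** As g has a single cycle, the contraction contains one factor n, which cancels 1/n, and m^#(t)
    provides one m for each block. *)
Lemma limit_moment m q :
  unital_mod_scalars (@phi R s N p) -> p \in Peven (s + s)%N (s + s)%N ->
  \sum_(t | geodesic (ord_cycle q.+1) t) genus_weight m t =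
  \sum_(sigma : {set {set 'I_q.+1}} | noncrossing sigma)
    \prod_(V in sigma) (m%:R * (\tr (Lambda (@phi R s N p) ^+ #|V|) / n%:R)).
Proof.
move=> unital p_even; rewrite sum_noncrossing; apply: eq_bigr => t geo.
have n0 : n%:R != 0 :> R[i] by rewrite pnatr_eq0 -lt0n expn_gt0 N_gt0.
rewrite /genus_weight (@geodesic_contraction _ _ _ _ _
  (fun l => \tr (Lambda (@phi R s N p) ^+ l) / n%:R)) //.
- rewrite card_ord porbits_ord_cycle cards1 expr1 mulrACA mulVf // mul1r.
  rewrite [RHS]big_split /= prodr_const; congr (_ * _).
  by apply: eq_bigr => V _; rewrite sum1_card.
- exact: tensor_power0.
- exact: tensor_powerD.
- by move=> l b d; rewrite Lambda_partial_trace.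
- by rewrite card_ord.
- by rewrite card_ord.
Qed.

End ExpectedMoments.

(** * The limit of large d *)

Section Limit.
Variable R : realType.

Lemma cvg_natr_quotient (a b : nat) : (a <= b)%N ->
  ((fun d => d%:R ^+ a / d%:R ^+ b : R[i]^o) @ \oo --> ((a == b)%:R : R[i]^o))%classic.
Proof.
move=> ab; apply/cvgrPdist_lt => eps eps0.
(* A positive element of R[i] is real. *)
have [x x0 ->] : exists2 x : R, 0 < x & eps = x%:C.
  by case: eps eps0 => x y; rewrite ltcE /= => /andP[/eqP -> x0]; exists x.
have [M _ HM] := nbhs_infty_gtr x^-1.
exists M.+1 => // d /= Md.
have dx : x^-1 < d%:R by apply: HM; rewrite /= ltnW.
have d0 : (0 < d)%N by rewrite (leq_trans _ Md).
have dR : d%:R != 0 :> R[i] by rewrite pnatr_eq0 -lt0n.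
move: ab; rewrite leq_eqVlt => /predU1P[->|ltab].
  by rewrite eqxx divff ?expf_neq0 // subrr normr0 ltcR.
rewrite (ltn_eqF ltab) sub0r normrN.
have -> : d%:R ^+ a / d%:R ^+ b = ((d%:R^-1 : R) ^+ (b - a))%:C :> R[i].
  rewrite rmorphXn fmorphV rmorph_nat /= -{1}(subnK (ltnW ltab)) exprD invfM.
  by rewrite mulrCA divff ?expf_neq0 // mulr1 exprVn.
have d1 : (d%:R^-1 : R) <= 1 by rewrite invf_le1 ?ltr0n // ler1n.
have dge : 0 <= (d%:R^-1 : R) by rewrite invr_ge0.
rewrite ger0_norm ?lecR ?exprn_ge0 // ltcR.
have [k ->] : exists k, (b - a = k.+1)%N.
  by exists (b - a).-1; rewrite prednK // subn_gt0.
rewrite exprS; apply: le_lt_trans (_ : d%:R^-1 < x).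
  by rewrite ler_piMr // exprn_ile1.
by rewrite invf_plt ?posrE ?ltr0n.
Qed.

End Limit.

(** On no points the empty partition is the only one, and it contributes an empty product. *)
Lemma distribution_nil (R : realType) (kappa : star_distribution R) :
  distribution_of_free_cumulants kappa [::] = 1.
Proof.
rewrite /distribution_of_free_cumulants (big_pred1 finset.set0) ?finset.big_set0 //.
move=> sigma; have T0 : [set: 'I_0]%SET = finset.set0 by apply/setP => -[].
apply/idP/eqP => [/andP[]|->].
  by rewrite T0 partition_set0 => /eqP.
rewrite /noncrossing T0 partition_set0 eqxx /=.
by apply/forall_inP => V; rewrite finset.in_set0.
Qed.

Theorem theorem6p3 (R : realType) (s N m : nat)
  (hN : (0 < N)%N) (hm : (0 < m)%N)
  (p : {set {set row_point (s + s)%N (s + s)%N}})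
  (hp : p \in Peven (s + s)%N (s + s)%N)
  (hsym : p = pcirc p)
  (hunital : unital_mod_scalars (@phi R s N p))
  (hunital_star : unital_mod_scalars (@phi R s N (pstar p)))
  (disp : nat -> measure_display)
  (T : forall d, measurableType (disp d))
  (P : forall d, probability (T d) R)
  (W : forall d, T d -> 'M[R[i]]_(d * N ^ s))
  (hW : forall d, complex_wishart (P d) (d * m) (W d)) :
  cvg_in_star_moments P
    (fun d t => m%:R *: block_map (phi p) (W d t))
    (compound_free_poisson
       (scale_distribution (m * N ^ s)%:R (law (Lambda (@phi R s N p))))).
Proof.
move=> e.
have n_gt0 : (0 < N ^ s)%N by rewrite expn_gt0 hN.
have n0 : (N ^ s)%:R != 0 :> R[i] by rewrite pnatr_eq0 -lt0n.
(* The moment of the empty word is 1 as soon as d > 0, so this case is settled eventually in d. *)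
case es : (size e) => [|q].
  rewrite (size0nil es) /compound_free_poisson distribution_nil.
  apply: (@cvg_trans _ ((fun=> 1 : R[i]^o) @ \oo)%classic); last exact: cvg_cst.
  apply: near_eq_cvg; exists 1 => // d /= d0.
  rewrite -(complex_expectation1 (P d)); congr complex_expectation; apply/funext => t.
  by rewrite /law big_nil mxtrace1 divff // pnatr_eq0 -lt0n muln_gt0 d0.
(* The limit is written as a sum over all permutations, with each power of d replaced by its
   limit. *)
have -> : compound_free_poisson (scale_distribution (m * N ^ s)%:R
    (law (Lambda (@phi R s N p)))) e =
  \sum_(t : 'S_q.+1) genus_weight R N p m t *
    ((#|porbits (t^-1 * ord_cycle q.+1)%g| + #|porbits t| == q.+2)%N)%:R.
  transitivity (\sum_(t | geodesic (ord_cycle q.+1) t) genus_weight R N p m t).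
    rewrite limit_moment // -es; apply: eq_bigr => sigma _; apply: eq_bigr => V _.
    (* The law of [Lambda] divides the trace by n^2, and the mass mn turns this into the factor
       m/n. *)
    rewrite /scale_distribution law_selfadjoint ?adjmx_Lambda // /subword size_map -cardE.
    by rewrite !natrM invfM -mulrA; congr (_ * _); rewrite mulrCA mulVKf.
  rewrite big_mkcond; apply: eq_bigr => t _; rewrite /geodesic porbits_ord_cycle cards1.
  by rewrite card_ord addn1; case: eqP => _; rewrite ?mulr1 ?mulr0.
pose F d : R[i]^o := \sum_(t : 'S_q.+1) genus_weight R N p m t *
    (d%:R ^+ (#|porbits (t^-1 * ord_cycle q.+1)%g| + #|porbits t|) / d%:R ^+ q.+2).
apply: (@cvg_trans _ (F @ \oo)%classic).
  apply: near_eq_cvg; exists 1 => // d /= d0; apply/esym.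
  exact: expected_moment.
rewrite /F; apply: cvg_big => [|t _]; first exact: add_continuous.
 apply: cvgM; first exact: cvg_cst.
apply: cvg_natr_quotient.
have := genus_bound (ord_cycle q.+1) t.
by rewrite porbits_ord_cycle cards1 card_ord addn1.
Qed.
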